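(* For every $d\ge 1$, every multi-index $\boldsymbol{\alpha}\in\mathbb{N}_0^d$ and all positive integers $m,n$ there is a constant $C(m,n,\boldsymbol{\alpha},d)>0$, depending only on $m,n,\boldsymbol{\alpha},d$, such that the following holds. Let $K\subset\mathbb{R}^d$ be a simple, non-degenerate, convex $d$-dimensional polytope with facet set $F$ and vertex set $V$, and let $\phi_{\boldsymbol{v}}$, $\boldsymbol{v}\in V$, be its Wachspress coordinates. Then for every $\boldsymbol{v}\in V$ and every $\boldsymbol{x}\in K$, $$\left|D^{\boldsymbol{\alpha}}\phi_{\boldsymbol{v}}(\boldsymbol{x})\right|\le C(|F|,|V|,\boldsymbol{\alpha},d)\sum_{\substack{\boldsymbol{0}\le\boldsymbol{\beta}\le\boldsymbol{\alpha}\\ |\boldsymbol{\alpha}-\boldsymbol{\beta}|\le|F|-d}}\ \sum_{\min\{|\boldsymbol{\beta}|,1\}\le\lambda\le|\boldsymbol{\beta}|}\frac{h_K^{|F|(1+\lambda)-|\boldsymbol{\alpha}|}}{h_*^{|F|(1+\lambda)}},$$ where $\boldsymbol{\beta}$ ranges over multi-indices in $\mathbb{N}_0^d$ and $\lambda$ over integers.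
   Context: Polytopes: a $d$-dimensional convex polytope $K\subset\mathbb{R}^d$ is the convex hull of finitely many points whose affine hull is $\mathbb{R}^d$. Faces are intersections of $K$ with supporting hyperplanes; vertices are the $0$-dimensional faces and facets the $(d-1)$-dimensional faces. $V$ and $F$ are the sets of vertices and facets; $|V|,|F|$ are their cardinalities. For $f\in F$, $V_f$ is the set of vertices contained in $f$; for $\boldsymbol{v}\in V$, $F_{\boldsymbol{v}}$ is the set of facets containing $\boldsymbol{v}$. Non-degenerate: adjacent facets do not lie in the same hyperplane. Simple: $|F_{\boldsymbol{v}}|=d$ for all $\boldsymbol{v}\in V$. Sizes: $h_K$ is the diameter of $K$. For $\boldsymbol{x}\in K$ and $f\in F$, $h_f(\boldsymbol{x})$ is the distance from $\boldsymbol{x}$ to the hyperplane containing $f$; $h_f(\boldsymbol{x})=(\boldsymbol{v}-\boldsymbol{x})\cdot\boldsymbol{n}_f$ for any $\boldsymbol{v}\in V_f$, where $\boldsymbol{n}_f$ is the unit outward normal of $f$. $h_*=\min_{f\in F}\min_{\boldsymbol{v}\in V\setminus V_f}h_f(\boldsymbol{v})$. Wachspress coordinates: for $\boldsymbol{v}\in V$ with $F_{\boldsymbol{v}}=\{f_1,\dots,f_d\}$, let $M_{\boldsymbol{v}}=[\boldsymbol{n}_{f_1},\dots,\boldsymbol{n}_{f_d}]\in\mathbb{R}^{d\times d}$, with the facets ordered so that $\det(M_{\boldsymbol{v}})>0$. Set $w_{\boldsymbol{v}}(\boldsymbol{x})=\det(M_{\boldsymbol{v}})\prod_{f\in F\setminus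 F_{\boldsymbol{v}}}h_f(\boldsymbol{x})$, $W=\sum_{\boldsymbol{u}\in V}w_{\boldsymbol{u}}$, and $\phi_{\boldsymbol{v}}=w_{\boldsymbol{v}}/W$ on $K$ (here $W>0$ on $K$). Derivatives at points of $K$, including boundary points, are those of the rational function $w_{\boldsymbol{v}}/W$ (with each $h_f$ regarded as an affine polynomial). Multi-indices: $|\boldsymbol{\alpha}|=\sum_i\alpha_i$, $D^{\boldsymbol{\alpha}}=\partial^{|\boldsymbol{\alpha}|}/\partial x_1^{\alpha_1}\cdots\partial x_d^{\alpha_d}$, and $\boldsymbol{\beta}\le\boldsymbol{\alpha}$ means $\beta_i\le\alpha_i$ for all $i$. *)

(* Defs.v *)
From HB Require Import structures.
From mathcomp Require Import all_boot all_order all_algebra all_fingroup.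
From mathcomp Require Import finmap.
From mathcomp Require Import all_classical all_reals all_analysis.

Set Implicit Arguments.
Unset Strict Implicit.
Unset Printing Implicit Defensive.

Import Order.TTheory GRing.Theory Num.Theory.
Import numFieldNormedType.Exports.

Local Open Scope classical_set_scope.
Local Open Scope card_scope.
Local Open Scope ring_scope.

(* The library norm on 'rV[R]_d is the sup norm, so the Euclidean structure
   has to be introduced separately. *)
Section Euclid.
Context {R : realType} {d : nat}.
Implicit Types (x y : 'rV[R]_d) (A : set 'rV[R]_d).

Definition dot x y : R := \sum_(i < d) x 0 i * y 0 i.

Definition enorm x : R := Num.sqrt (dot x x).

Definition diameter A : R :=
  sup [set r | exists x y, [/\ A x, A y & r = enorm (x - y)]].

End Euclid.

Section AffineGeometry.
Context {R : realType} {d : nat}.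
Implicit Types (x y n : 'rV[R]_d) (A : set 'rV[R]_d) (b : R).

Definition affine_hull A : set 'rV[R]_d :=
  [set y | exists N (p : 'I_N -> 'rV[R]_d) (c : 'I_N -> R),
     [/\ forall i, A (p i), \sum_i c i = 1 & y = \sum_i c i *: p i]].

Definition convex_hull A : set 'rV[R]_d :=
  [set y | exists N (p : 'I_N -> 'rV[R]_d) (c : 'I_N -> R),
     [/\ forall i, A (p i), forall i, 0 <= c i, \sum_i c i = 1
       & y = \sum_i c i *: p i]].

(* The affine hull of A is a translate of a k-dimensional linear subspace,
   given as the row space of a matrix of rank k. *)
Definition has_affine_dim A (k : nat) : Prop :=
  exists x0 (U : 'M[R]_d),
    \rank U = k /\ affine_hull A = [set x | (x - x0 <= U)%MS].

Definition hyperplane n b : set 'rV[R]_d := [set y | dot n y = b].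

End AffineGeometry.

Section Polytopes.
Context {R : realType} {d : nat}.
Implicit Types (x n v : 'rV[R]_d) (K f g : set 'rV[R]_d) (b : R).

Definition polytope K : Prop :=
  exists P : set 'rV[R]_d,
    [/\ finite_set P, K = convex_hull P & affine_hull P = setT].

Definition supporting K n b : Prop :=
  [/\ n != 0, forall y, K y -> dot n y <= b & K `&` hyperplane n b !=set0].

Definition face K (k : nat) f : Prop :=
  (exists n b, supporting K n b /\ f = K `&` hyperplane n b)
  /\ has_affine_dim f k.

Definition vertices K : set 'rV[R]_d := [set v | face K 0 [set v]].

Definition facets K : set (set 'rV[R]_d) := [set f | face K d.-1 f].

Definition facet_vertices K f : set 'rV[R]_d := [set v | vertices K v /\ f v].

Definition vertex_facets K v : set (set 'rV[R]_d) :=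
  [set f | facets K f /\ f v].

(* Two facets are adjacent when they share a (d-2)-dimensional face. With
   facets cut out by supporting hyperplanes, [nondegenerate_polytope] holds for every
   polytope; it is a restriction only for a facet list given as data. *)
Definition adjacent f g : Prop :=
  exists2 k, k.+2 = d & has_affine_dim (f `&` g) k.

Definition nondegenerate_polytope K : Prop :=
  forall f g, facets K f -> facets K g -> f <> g -> adjacent f g ->
    ~ exists n b, n != 0 /\ f `|` g `<=` hyperplane n b.

Definition simple_polytope K : Prop :=
  forall v, vertices K v -> vertex_facets K v #= `I_d.

Definition outward_normal K f n : Prop :=
  enorm n = 1 /\ exists b, supporting K n b /\ f = K `&` hyperplane n b.

Definition facet_normal K f : 'rV[R]_d := xget 0 [set n | outward_normal K f n].

(* An affine function of x on the whole space; on K it is the distance to the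
   hyperplane containing f. The value does not depend on the vertex chosen. *)
Definition facet_height K f x : R :=
  dot (xget 0 (facet_vertices K f) - x) (facet_normal K f).

(* The minimum over a finite nonempty set, written as an infimum. *)
Definition hstar K : R :=
  inf [set r | exists f v,
    [/\ facets K f, vertices K v, ~ f v & r = facet_height K f v]].

End Polytopes.

Section Wachspress.
Context {R : realType} {d : nat}.
Implicit Types (x v : 'rV[R]_d) (K : set 'rV[R]_d).

Definition normal_mx K (nu : 'I_d -> set 'rV[R]_d) : 'M[R]_d :=
  \matrix_(i < d, j < d) facet_normal K (nu j) 0 i.

(* The facets at v are to be ordered so that the determinant of their normals
   is positive; as reordering only affects the sign, this is the absolute
   value for an arbitrary ordering (see [vertex_detE]). For d = 1 no
   reordering is available and the absolute value is what is meant. *)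
Definition vertex_det K v : R :=
  `|\det (normal_mx K
      (fun j : 'I_d => nth set0 (fset_set (vertex_facets K v)) j))|.

Lemma vertex_detE K v (nu : 'I_d -> set 'rV[R]_d) :
  vertex_facets K v #= `I_d -> injective nu ->
  (forall j, vertex_facets K v (nu j)) ->
  0 < \det (normal_mx K nu) -> vertex_det K v = \det (normal_mx K nu).
Proof.
move=> cardF nu_inj nuF det_gt0.
have finF : finite_set (vertex_facets K v) by exists d.
rewrite /vertex_det; set s := enum_fset _.
have szs : size s = d by exact: (card_fset_set cardF).
have nus j : nu j \in s by rewrite in_fset_set// inE.
have idx j : (index (nu j) s < d)%N by rewrite -[ltnRHS]szs index_mem.
pose t j := Ordinal (idx j).
have nthK j : nth set0 s (t j) = nu j by rewrite nth_index.
have t_inj : injective t by move=> i j /(congr1 val) /= ij;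
  apply: nu_inj; rewrite -[LHS]nthK -[RHS]nthK /= ij.
have nuE : normal_mx K nu =
    col_perm (perm t_inj) (normal_mx K (fun j : 'I_d => nth set0 s j)).
  by apply/matrixP => i j; rewrite !mxE permE nthK.
move: det_gt0; rewrite nuE.
rewrite col_permE det_mulmx det_perm => det_gt0.
by rewrite -(gtr0_norm det_gt0) normrM normr_sign mulr1.
Qed.

Definition wachspress_weight K v x : R :=
  vertex_det K v *
  \big[*%R/1]_(f \in facets K `\` vertex_facets K v) facet_height K f x.

Definition wachspress K v x : R :=
  wachspress_weight K v x / \sum_(u \in vertices K) wachspress_weight K u x.

End Wachspress.

Section MultiIndices.
Context {d : nat}.
Implicit Types alpha beta : {ffun 'I_d -> nat}.

Definition mi_size alpha : nat := (\sum_(i < d) alpha i)%N.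

Definition mi_le beta alpha : Prop := forall i, (beta i <= alpha i)%N.

Definition mi_sub alpha beta : {ffun 'I_d -> nat} :=
  [ffun i => (alpha i - beta i)%N].

Context {R : realType}.

Definition partial (i : 'I_d) (g : 'rV[R]_d -> R) : 'rV[R]_d -> R :=
  fun x => 'D_(delta_mx 0 i) g x.

Definition mderive alpha (g : 'rV[R]_d -> R) : 'rV[R]_d -> R :=
  foldr (fun i => iter (alpha i) (partial i)) g (enum 'I_d).

End MultiIndices.

(* Main.v *)
(* With r = diameter / hstar >= 1, the summand beta = alpha, lambda = |alpha| of the
   right-hand side equals r^(m(1+|alpha|)) / diameter^|alpha|, and it suffices to
   bound the derivative by a multiple of it. The weights are products of m-d affine
   heights bounded by the diameter and with gradients of norm 1, so each derivative
   of a weight or of their sum W costs at most a factor const/diameter. If x is a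
   convex combination of the vertices, the vertex v of largest coefficient has
   coefficient at least 1/n, so each facet not through v is at height at least
   hstar/n above x; and the normals at v are dual to vectors along the edges at v,
   which gives det M_v >= (hstar/diameter)^d / d!. Hence W is at least a constant
   times hstar^m / diameter^d on K, and each derivative of 1/W costs a factor
   const * r^m / diameter.

   The polytope theory behind this (a polytope is the hull of its vertices and the
   intersection of its facet half-spaces) is derived from the Farkas lemma. *)
Require Import Defs.
From mathcomp Require Import all_boot all_order all_algebra all_fingroup.
From mathcomp Require Import all_classical all_reals all_analysis.
From mathcomp Require Import finmap ring.

Import Order.TTheory GRing.Theory Num.Theory.
Import numFieldNormedType.Exports.

Local Open Scope classical_set_scope.
Local Open Scope card_scope.
Local Open Scope ring_scope.

(** * The Euclidean dot product *)

Section DotProduct.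
Context {R : realType} {d : nat}.
Implicit Types (x y z : 'rV[R]_d) (c : R).

Lemma dotC x y : dot x y = dot y x.
Proof. by apply: eq_bigr => i _; rewrite mulrC. Qed.

Lemma dotDl x y z : dot (x + y) z = dot x z + dot y z.
Proof. by rewrite /dot -big_split; apply: eq_bigr => i _; rewrite mxE mulrDl. Qed.

Lemma dotZl c x y : dot (c *: x) y = c * dot x y.
Proof. by rewrite /dot mulr_sumr; apply: eq_bigr => i _; rewrite mxE mulrA. Qed.

Lemma dotNl x y : dot (- x) y = - dot x y.
Proof. by rewrite -scaleN1r dotZl mulN1r. Qed.

Lemma dotBl x y z : dot (x - y) z = dot x z - dot y z.
Proof. by rewrite dotDl dotNl. Qed.

Lemma dot0l x : dot 0 x = 0.
Proof. by rewrite -(scale0r x) dotZl mul0r. Qed.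

Lemma dotDr x y z : dot z (x + y) = dot z x + dot z y.
Proof. by rewrite dotC dotDl !(dotC z). Qed.

Lemma dotZr c x y : dot y (c *: x) = c * dot y x.
Proof. by rewrite dotC dotZl (dotC y). Qed.

Lemma dotNr x y : dot y (- x) = - dot y x.
Proof. by rewrite dotC dotNl (dotC y). Qed.

Lemma dotBr x y z : dot z (x - y) = dot z x - dot z y.
Proof. by rewrite dotDr dotNr. Qed.

Lemma dot0r x : dot x 0 = 0.
Proof. by rewrite dotC dot0l. Qed.

Lemma dot_sumr (I : Type) (r : seq I) (F : I -> 'rV[R]_d) x :
  dot x (\sum_(i <- r) F i) = \sum_(i <- r) dot x (F i).
Proof.
by elim/big_rec2: _ => [|i a b _ <-]; rewrite ?dot0r ?dotDr.
Qed.

Lemma dot_deltal i x : dot (delta_mx 0 i) x = x 0 i.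
Proof.
rewrite /dot (bigD1 i)//= big1 ?addr0; last first.
  by move=> j ji; rewrite mxE (negbTE ji) andbF mul0r.
by rewrite mxE !eqxx mul1r.
Qed.

Lemma dot_ge0 x : 0 <= dot x x.
Proof. by apply: sumr_ge0 => i _; rewrite -expr2 sqr_ge0. Qed.

Lemma dot_eq0 x : (dot x x == 0) = (x == 0).
Proof.
apply/idP/eqP => [|->]; last by rewrite dot0l.
rewrite psumr_eq0 => [/allP h|i _]; last by rewrite -expr2 sqr_ge0.
apply/rowP => i; rewrite mxE; apply/eqP.
by have := h i (mem_index_enum i); rewrite /= mulf_eq0 orbb.
Qed.

End DotProduct.

(** * The Farkas lemma and extreme functionals *)

(* Bartl's induction: project the remaining vectors along the last one. *)
Lemma farkas {R : realType} {k : nat} (I : eqType) (s : seq I)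
    (a : I -> 'rV[R]_k) (b : 'rV[R]_k) : uniq s ->
  (forall x, (forall i, i \in s -> dot (a i) x <= 0) -> dot b x <= 0) ->
  exists2 c : I -> R, (forall i, 0 <= c i) & b = \sum_(i <- s) c i *: a i.
Proof.
elim: s a b => [|j s IH] a b.
  move=> _ h; exists (fun=> 0) => //; rewrite big_nil.
  by apply/eqP; rewrite -dot_eq0 eq_le dot_ge0 andbT; apply: h.
move=> /andP[js us] h.
have upd (c : I -> R) (t : R) (F : I -> 'rV[R]_k) :
    \sum_(i <- s) (if i == j then t else c i) *: F i = \sum_(i <- s) c i *: F i.
  apply: eq_big_seq => i si; case: eqP => // ij.
  by rewrite -ij si in js.
have [h0|] :=
    pselect (forall x, (forall i, i \in s -> dot (a i) x <= 0) -> dot b x <= 0).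
  have [c c0 cE] := IH a b us h0.
  exists (fun i => if i == j then 0 else c i); first by move=> i; case: ifP.
  by rewrite big_cons eqxx scale0r add0r upd.
move=> /existsNP[z /not_implyP[zs /negP]]; rewrite -ltNge => bz.
have jz : 0 < dot (a j) z.
  rewrite ltNge; apply/negP => jz; have : dot b z <= 0.
    by apply: h => i; rewrite inE => /predU1P[->//|]; apply: zs.
  by rewrite leNgt bz.
pose e i := dot (a i) z / dot (a j) z.
have [|c c0 cE] := IH (fun i => a i - e i *: a j)
  (b - (dot b z / dot (a j) z) *: a j) us.
  move=> x xs.
  (* Moving [x] along [z] into the kernel of [a j] makes constraint [j] an equality, and the
     original functionals at [x'] are the projected ones at [x]. *)
  pose x' := x - (dot (a j) x / dot (a j) z) *: z.
  have x'E y : dot y x' =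
      dot (y - (dot y z / dot (a j) z) *: a j) x.
    rewrite /x' dotBr dotZr dotBl dotZl.
    by field; rewrite gt_eqF.
  rewrite -x'E; apply: h => i; rewrite inE => /predU1P[->|si].
    by rewrite x'E divff ?gt_eqF// scale1r subrr dot0l.
  by rewrite x'E; apply: xs.
(* The coefficient of [a j] after undoing the projection. It is nonnegative because [dot b z] is
   positive while every [e i] with [i] in [s] is nonpositive. *)
pose t := dot b z / dot (a j) z - \sum_(i <- s) c i * e i.
exists (fun i => if i == j then t else c i).
  move=> i; case: ifP => // _; rewrite subr_ge0 (@le_trans _ _ 0)//.
    rewrite big_seq; apply: sumr_le0 => l ls.
    by rewrite mulr_ge0_le0// mulr_le0_ge0 ?zs// invr_ge0 ltW.
  by rewrite divr_ge0// ltW.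
rewrite big_cons eqxx upd.
move/eqP: cE; rewrite subr_eq => /eqP ->.
under eq_bigr do rewrite scalerBr scalerA.
rewrite sumrB -scaler_suml /t scalerBl addrC addrA addrAC.
by rewrite -addrA addrC.
Qed.

(* Among functionals nonpositive on the a_i, one whose active set is not
   maximal can be moved, keeping its active constraints, until it picks up a new one. *)
Lemma extreme_functional {R : realType} {k : nat} (I : finType)
    (a : I -> 'rV[R]_k) (z l : 'rV[R]_k) :
  (forall x, (forall i, dot (a i) x = 0) -> x = 0) ->
  (forall i, dot (a i) l <= 0) -> 0 < dot z l ->
  exists l', [/\ forall i, dot (a i) l' <= 0, 0 < dot z l' &
    forall x, (forall i, dot (a i) l' = 0 -> dot (a i) x = 0) ->
      exists c, x = c *: l'].
Proof.
move=> span.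
have [N] := ubnP #|[pred i | dot (a i) l != 0]|.
elim: N l => // N IH l cardl lneg zl.
have [ext|] := pselect (forall x, (forall i, dot (a i) l = 0 -> dot (a i) x = 0) ->
      exists c, x = c *: l); first by exists l.
move=> /existsNP[y /not_implyP[ys yl]].
pose g := \sum_i a i.
have gE x : dot g x = \sum_i dot (a i) x.
  by rewrite dotC dot_sumr; under eq_bigr do rewrite dotC.
have allz x : (forall i, dot (a i) x <= 0) -> dot g x = 0 -> x = 0.
  move=> xneg gx; apply: span => i; apply/eqP; rewrite -oppr_eq0.
  have : \sum_i - dot (a i) x == 0 by rewrite sumrN -gE gx oppr0.
  rewrite psumr_eq0 => [/allP h|j _]; last by rewrite oppr_ge0.
  exact: (h i (mem_index_enum i)).
have gl : dot g l != 0.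
  apply: contraTneq zl => /(allz _ lneg) ->; by rewrite dot0r ltxx.
(* Subtracting a multiple of [l] from [y] puts it in the kernel of [g] and keeps the active
   constraints. By [allz], a nonzero vector of that kernel is positive on some [a i], so moving
   along it must eventually hit a constraint. *)
pose w0 := y - (dot g y / dot g l) *: l.
have w0n : w0 != 0.
  by apply: contra_notN yl => /eqP/subr0_eq ->; eexists.
have w0g : dot g w0 = 0 by rewrite dotBr dotZr divfK// subrr.
have w0s i : dot (a i) l = 0 -> dot (a i) w0 = 0.
  by move=> il; rewrite dotBr dotZr il mulr0 ys// subrr.
(* The sign of [w0] is chosen so that the move does not decrease the value at [z]. *)
have [w [wn wg ws wz]] : exists w, [/\ w != 0, dot g w = 0,
    forall i, dot (a i) l = 0 -> dot (a i) w = 0 & 0 <= dot z w].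
  case: (lerP 0 (dot z w0)) => [|/ltW] wz; first by exists w0.
  exists (- w0); rewrite oppr_eq0 !dotNr w0g oppr0 oppr_ge0; split => //.
  by move=> i il; rewrite dotNr w0s ?oppr0.
have [i0 i0w] : exists i0, 0 < dot (a i0) w.
  apply: contrapT => /forallNP h; case/eqP: wn; apply: allz => // i.
  by rewrite leNgt; apply/negP.
(* Ratio test: [q i] is the step along [w] at which constraint [i] becomes active, and the least
   such step violates none. *)
pose q i := - dot (a i) l / dot (a i) w.
case: (@arg_minP _ _ _ i0 (fun i => 0 < dot (a i) w) q i0w) => m mw mmin.
have il i : 0 < dot (a i) w -> dot (a i) l < 0.
  move=> iw; rewrite lt_neqAle lneg andbT; apply: contraTneq iw => /ws ->.
  by rewrite ltxx.
have qm : 0 < q m by rewrite divr_gt0// oppr_gt0 il.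
apply: (IH (l + q m *: w)).
- apply: (@leq_trans #|[pred i | dot (a i) l != 0]|) => //.
  apply: proper_card; apply/properP; split.
    apply/fintype.subsetP => i; rewrite !inE; apply: contraNN => /eqP il0.
    by rewrite dotDr dotZr il0 ws// mulr0 addr0.
  exists m; rewrite !inE; first by rewrite lt_eqF// il.
  by rewrite negbK dotDr dotZr /q divfK ?subrr // lt0r_neq0.
- move=> i; rewrite dotDr dotZr.
  case: (ltrP 0 (dot (a i) w)) => iw.
    have := mmin i iw; rewrite {2}/q ler_pdivlMr// => h.
    by rewrite addrC -lerBrDr sub0r.
  by rewrite -(addr0 0) lerD ?lneg// mulr_ge0_le0// ltW.
- by rewrite dotDr dotZr ltr_wpDr// mulr_ge0// ltW.
Qed.

(** * Homogenization: affine functions as linear functionals in one more dimension *)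

Section Homogenization.
Context {R : realType} {d : nat}.
Implicit Types (p n : 'rV[R]_d) (b : R).

Definition lift1 p : 'rV[R]_(d + 1) := row_mx p (const_mx 1).

Definition functional n b : 'rV[R]_(d + 1) := row_mx n (const_mx (- b)).

Lemma dot_lift1 p n b : dot (lift1 p) (functional n b) = dot n p - b.
Proof.
rewrite /dot big_split_ord /= big_ord1 !row_mxEr !mxE mul1r; congr (_ + _).
by apply: eq_bigr => i _; rewrite !row_mxEl mulrC.
Qed.

Lemma functionalE (l : 'rV[R]_(d + 1)) :
  l = functional (lsubmx l) (- l 0 (rshift d 0)).
Proof.
rewrite /functional opprK -[LHS]hsubmxK; congr (row_mx _ _).
by apply/rowP => i; rewrite !mxE ord1.
Qed.

Lemma functional_inj n b n' b' :
  functional n b = functional n' b' -> n = n' /\ b = b'.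
Proof.
by move=> /eq_row_mx[-> /rowP/(_ 0)]; rewrite !mxE => /oppr_inj.
Qed.

Lemma functionalZ c n b : c *: functional n b = functional (c *: n) (c * b).
Proof.
rewrite /functional scale_row_mx; congr row_mx.
by apply/rowP => i; rewrite !mxE mulrN.
Qed.

End Homogenization.

(** * Convex hulls of finite lists and separation *)

Section SeqHull.
Context {R : realType} {d : nat}.
Implicit Types (x z p n : 'rV[R]_d) (b : R) (s : seq 'rV[R]_d)
  (K f : set 'rV[R]_d).

(** Coefficients are attached to points rather than positions, which is the form produced by
    [farkas]; [convex_hull_seq] relates it to [convex_hull]. *)
Definition seq_hull s : set 'rV[R]_d :=
  [set x | exists c : 'rV[R]_d -> R,
     [/\ forall p, 0 <= c p, \sum_(p <- s) c p = 1
       & x = \sum_(p <- s) c p *: p]].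

Lemma dot_comb s (c : 'rV[R]_d -> R) n b : \sum_(p <- s) c p = 1 ->
  b - dot n (\sum_(p <- s) c p *: p) = \sum_(p <- s) c p * (b - dot n p).
Proof.
move=> c1; rewrite dot_sumr -[in LHS](mul1r b) -c1 mulr_suml -sumrB.
by apply: eq_bigr => p _; rewrite dotZr mulrBr.
Qed.

Lemma mem_seq_hull s p : uniq s -> p \in s -> seq_hull s p.
Proof.
move=> us ps; exists (fun q => (q == p)%:R); split => [q||]; first exact: ler0n.
  by rewrite (bigD1_seq p)//= eqxx big1 ?addr0// => q /negbTE ->.
rewrite (bigD1_seq p)//= eqxx scale1r big1 ?addr0// => q /negbTE ->.
by rewrite scale0r.
Qed.

Lemma dot_seq_hull_le s n b x :
  (forall p, p \in s -> dot n p <= b) -> seq_hull s x -> dot n x <= b.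
Proof.
move=> sb [c [c0 c1 ->]]; rewrite -subr_ge0 dot_comb// big_seq sumr_ge0// => p ps.
by rewrite mulr_ge0// subr_ge0 sb.
Qed.

Lemma dot_seq_hull_eq s n b x :
  (forall p, p \in s -> dot n p = b) -> seq_hull s x -> dot n x = b.
Proof.
move=> sb [c [c0 c1 ->]]; apply/eqP; rewrite eq_sym -subr_eq0 dot_comb//.
by rewrite big_seq big1// => p ps; rewrite sb// subrr mulr0.
Qed.

(** The slack of a convex combination is the weighted sum of the nonnegative slacks of its points,
    so when it vanishes every point of nonzero weight has slack zero. *)
Lemma hull_tight s n b (c : 'rV[R]_d -> R) :
  (forall p, p \in s -> dot n p <= b) -> (forall p, 0 <= c p) ->
  \sum_(p <- s) c p = 1 -> dot n (\sum_(p <- s) c p *: p) = b ->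
  forall p, p \in s -> c p != 0 -> dot n p = b.
Proof.
move=> sb c0 c1 cb p ps cp.
have : \sum_(p <- s) c p * (b - dot n p) == 0 by rewrite -dot_comb// cb subrr.
rewrite big_seq psumr_eq0 => [/allP/(_ p ps)|q qs].
  by rewrite ps mulf_eq0 (negbTE cp) subr_eq0 => /eqP.
by rewrite mulr_ge0// subr_ge0 sb.
Qed.

(** If nothing separates, [farkas] writes [lift1 z] as a nonnegative combination of lifted points;
    the last coordinate forces the coefficients to sum to 1. *)
Lemma separation s z : uniq s -> ~ seq_hull s z ->
  exists n b, (forall p, p \in s -> dot n p <= b) /\ b < dot n z.
Proof.
move=> us zs; apply: contrapT => /forallNP nsep; apply: zs.
have [|c c0 cE] := farkas _ s lift1 (lift1 z) us.
  move=> l; rewrite (functionalE l); set n := lsubmx _; set b := - _ => sl.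
  rewrite dot_lift1 subr_le0 leNgt; apply/negP => zb.
  apply: (nsep n); exists b; split => // p ps.
  by rewrite -subr_le0 -dot_lift1 sl.
exists c; split => //.
- move/(congr1 (fun u : 'rV[R]_(d + 1) => u 0 (rshift d 0))): cE.
  rewrite row_mxEr mxE => ->; rewrite summxE.
  by apply: eq_bigr => p _; rewrite mxE row_mxEr mxE mulr1.
- move/(congr1 lsubmx): cE; rewrite row_mxKl => ->; rewrite linear_sum.
  by apply: eq_bigr => p _; rewrite linearZ /= row_mxKl.
Qed.

Lemma convex_hull_seq s : uniq s -> convex_hull [set` s] = seq_hull s.
Proof.
move=> us; apply/seteqP; split => x.
  move=> [N [p [c [ps c0 c1 ->]]]]; apply: contrapT => /(separation _ _ us).
  move=> [n [b [sb]]]; rewrite ltNge => /negP; apply.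
  rewrite dot_sumr -(mul1r b) -c1 mulr_suml; apply: ler_sum => i _.
  by rewrite dotZr ler_wpM2l// sb//; exact: ps.
move=> [c [c0 c1 ->]]; exists (size s), (tnth (in_tuple s)).
exists (fun i => c (tnth (in_tuple s) i)); split => //.
- by move=> i; exact: mem_tnth.
- by rewrite -c1 [RHS]big_tnth.
- by rewrite [LHS]big_tnth.
Qed.

(** Full dimensionality in dual form, convenient for functionals obtained by separation. *)
Definition solid K : Prop :=
  forall n b, (forall x, K x -> dot n x = b) -> n = 0.

Lemma polytope_solid K : polytope K -> solid K.
Proof.
move=> [P [_ -> aff]] n b nb.
have nP x : dot n x = b.
  have [N [p [c [pP c1 ->]]]] : affine_hull P x by rewrite aff.
  rewrite dot_sumr -(mul1r b) -c1 mulr_suml; apply: eq_bigr => i _.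
  rewrite dotZr nb//; exists 1%N, (fun=> p i), (fun=> 1).
  by split => //; rewrite big_ord1 // scale1r.
by apply/eqP; rewrite -dot_eq0 nP -(nP 0) dot0r.
Qed.

End SeqHull.

(** * A polytope is the hull of its vertices *)

Section Vertices.
Context {R : realType} {d : nat}.
Implicit Types (x z p n : 'rV[R]_d) (b : R) (s : seq 'rV[R]_d)
  (K f : set 'rV[R]_d).

(** Solidity gives [n = 0], and [K] has a point because every functional is constant on the empty
    set. *)
Lemma solid_neq K n b : (0 < d)%N -> solid K ->
  (forall x, K x -> dot n x = b) -> b = 0.
Proof.
move=> d0 sK nb; case: (pselect (exists x, K x)) => [[x Kx]|/forallNP K0].
  by rewrite -(nb _ Kx) (sK _ _ nb) dot0l.
have /rowP/(_ (Ordinal d0)) : (delta_mx 0 (Ordinal d0) : 'rV[R]_d) = 0.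
  by apply: (sK _ 0) => x /K0.
by rewrite !mxE !eqxx => /eqP; rewrite oner_eq0.
Qed.

(** A hyperplane separating [p] from the other points, shifted so as to pass through [p], supports
    the hull and meets it in [p] only. *)
Lemma exposed_vertex s p : (0 < d)%N -> uniq s -> solid (seq_hull s) ->
  p \in s -> ~ seq_hull [seq q <- s | q != p] p -> vertices (seq_hull s) p.
Proof.
move=> d0 us sK ps /separation[|n [b [nb bp]]]; first exact: filter_uniq.
have sb q : q \in s -> dot n q <= dot n p.
  move=> qs; have [->//|qp] := eqVneq q p.
  by rewrite (le_trans (nb q _) (ltW bp))// mem_filter /= qp.
split; last first.
  exists p, 0; split; first exact: mxrank0.
  apply/seteqP; split => y /=.
    move=> [N [q [c [qp c1 ->]]]]; rewrite submx0 subr_eq0; apply/eqP.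
    under eq_bigr => i _ do rewrite (qp i).
    by rewrite -scaler_suml c1 scale1r.
  rewrite submx0 subr_eq0 => /eqP ->; exists 1%N, (fun=> p), (fun=> 1).
  by split => //; rewrite big_ord1// scale1r.
have Kp : seq_hull s p by exact: mem_seq_hull.
(* With a zero normal the list would contain no point besides [p], and a single point is not solid
   in positive dimension. *)
have n0 : n != 0.
  apply/eqP => n0; move: bp nb; rewrite n0 dot0l => b0 nb.
  have sp q : q \in s -> q = p.
    move=> qs; apply/eqP; apply: contraTT b0 => qp.
    by rewrite -leNgt -(dot0l q) nb// mem_filter /= qp.
  have h e : e = 0 :> 'rV[R]_d.
    apply: (sK e (dot e p)) => x; apply: dot_seq_hull_eq => q /sp ->//.
  have /rowP/(_ (Ordinal d0)) := h (delta_mx 0 (Ordinal d0)).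
  by rewrite !mxE !eqxx => /eqP; rewrite oner_eq0.
exists n, (dot n p); split.
  split => //; first by move=> y; apply: dot_seq_hull_le.
  by exists p.
apply/seteqP; split => x /=; first by move=> ->.
move=> [[c [c0 c1 xE]] nx].
have tight := hull_tight _ _ _ _ sb c0 c1; rewrite -xE in tight.
rewrite xE -[RHS]scale1r -c1 scaler_suml; apply: eq_big_seq => q qs.
have [->|/(tight nx _ qs) qp] := eqVneq (c q) 0; first by rewrite !scale0r.
congr (_ *: _); apply/eqP; apply: contraT => qnp.
by have := nb q; rewrite mem_filter /= qnp qs qp leNgt bp => /(_ isT).
Qed.

(** Any half-space containing the remaining points contains [p] as well, so no point of the old hull
    can be separated from the new one. *)
Lemma seq_hull_filter s p : uniq s -> p \in s ->
  seq_hull [seq q <- s | q != p] p -> seq_hull [seq q <- s | q != p] = seq_hull s.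
Proof.
move=> us ps hp; apply/seteqP; split => x.
  move=> [c [c0 c1 xE]]; exists (fun q => if q != p then c q else 0).
  split; first by move=> q; case: ifP.
    by rewrite -c1 big_filter [RHS]big_mkcond.
  rewrite xE big_filter [LHS]big_mkcond /=; apply: eq_bigr => q _.
  by case: ifP => // _; rewrite scale0r.
move=> hx; apply: contrapT => /separation[|n [b [nb]]]; first exact: filter_uniq.
rewrite ltNge => /negP; apply; apply: dot_seq_hull_le hx => q qs.
have [->|qp] := eqVneq q p; first exact: dot_seq_hull_le hp.
by apply: nb; rewrite mem_filter /= qp.
Qed.

Lemma seq_hull_vertices s : (0 < d)%N -> uniq s -> solid (seq_hull s) ->
  exists s', [/\ uniq s', seq_hull s = seq_hull s' &
    forall p, p \in s' -> vertices (seq_hull s) p].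
Proof.
move=> d0; have [N] := ubnP (size s); elim: N s => // N IH s szs us sK.
have [h|] := pselect (forall p, p \in s -> vertices (seq_hull s) p).
  by exists s.
move=> /existsNP[p /not_implyP[ps pv]].
have hp : seq_hull [seq q <- s | q != p] p.
  by apply: contrapT => /exposed_vertex -/(_ d0 us sK ps).
rewrite -(seq_hull_filter _ _ us ps hp); apply: IH.
- rewrite size_filter -ltnS; apply: leq_trans szs; rewrite ltnS.
  by rewrite -(count_predC (pred1 p)) -[ltnLHS]add0n ltn_add2r -has_count has_pred1.
- exact: filter_uniq.
- by rewrite seq_hull_filter.
Qed.

Lemma polytope_vertices K : (0 < d)%N -> polytope K ->
  exists s, [/\ uniq s, K = seq_hull s & forall p, p \in s -> vertices K p].
Proof.
move=> d0 pK; have sK := polytope_solid _ pK.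
case: pK => P [/finite_seqP[s ->] KE _].
have us := undup_uniq s.
have KE' : K = seq_hull (undup s).
  rewrite KE -convex_hull_seq//; congr convex_hull.
  by apply/seteqP; split => x /=; rewrite mem_undup.
rewrite KE' in sK *; exact: seq_hull_vertices.
Qed.

End Vertices.

(** * Facets and the half-space description of a polytope *)

Section Facets.
Context {R : realType} {d : nat}.
Implicit Types (x z p n : 'rV[R]_d) (b : R) (s : seq 'rV[R]_d)
  (K f : set 'rV[R]_d).

Lemma enormZ (c : R) n : enorm (c *: n) = `|c| * enorm n.
Proof.
rewrite /enorm dotZl dotZr mulrA -expr2 sqrtrM ?sqr_ge0//.
by rewrite sqrtr_sqr.
Qed.

Lemma enorm_gt0 n : (0 < enorm n) = (n != 0).
Proof. by rewrite sqrtr_gt0 lt_neqAle dot_ge0 andbT eq_sym dot_eq0. Qed.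

(** Gathers what is used about a facet, so that the choices made by [xget] in [facet_normal] and
    [facet_height] stay hidden afterwards. *)
Definition facet_data K f n b : Prop :=
  [/\ enorm n = 1, forall y, K y -> dot n y <= b, f = K `&` hyperplane n b
    & forall x, facet_height K f x = b - dot n x].

Lemma facet_normal_spec K f : facets K f -> outward_normal K f (facet_normal K f).
Proof.
move=> [[n [b [[n0 nb [x [Kx nx]]] fE]]] _].
apply: (@xgetPex _ 0 [set n | outward_normal K f n]).
have e0 : 0 < enorm n by rewrite enorm_gt0.
have ei0 : 0 < (enorm n)^-1 by rewrite invr_gt0.
have hE y : (dot ((enorm n)^-1 *: n) y = (enorm n)^-1 * b) = (dot n y = b).
  apply/propext; rewrite dotZl; split => [|->//].
  by apply: mulfI; rewrite gt_eqF.
exists ((enorm n)^-1 *: n); split.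
  by rewrite enormZ gtr0_norm// mulVf// gt_eqF.
exists ((enorm n)^-1 * b); split; last first.
  rewrite fE; apply/seteqP; split => y [Ky ny]; split => //; move: ny;
    by rewrite /hyperplane /= hE.
split.
- by rewrite scaler_eq0 invr_eq0 negb_or n0 gt_eqF.
- by move=> y Ky; rewrite dotZl ler_pM2l// nb.
- by exists x; split => //; rewrite /hyperplane /= hE.
Qed.

(** By [hull_tight], the points of nonzero weight in a combination lying on the facet are on it too.
    This ensures that the base point in [facet_height] is a genuine vertex and not the default
    value. *)
Lemma facet_vertices_neq0 s f : (forall p, p \in s -> vertices (seq_hull s) p) ->
  uniq s -> facets (seq_hull s) f -> facet_vertices (seq_hull s) f !=set0.
Proof.
move=> sv us [[n [b [[n0 nb [x [[c [c0 c1 xE]] nx]]] fE]]] _].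
have sb p : p \in s -> dot n p <= b.
  by move=> ps; apply: nb; exact: mem_seq_hull.
have [p ps cp] : exists2 p, p \in s & c p != 0.
  apply: contrapT => h; have := oner_neq0 R; rewrite -c1 big_seq big1 ?eqxx//.
  move=> p ps; apply/eqP; apply: contraT => cp; case: h; by exists p.
exists p; split; first exact: sv.
rewrite fE; split; first exact: mem_seq_hull.
by apply: (hull_tight s _ _ c sb) => //; rewrite -xE.
Qed.

Lemma facet_dataP K f : (0 < d)%N -> polytope K -> facets K f ->
  exists b, facet_data K f (facet_normal K f) b.
Proof.
move=> d0 pK fK; have [en [b [[_ nb _] fE]]] := facet_normal_spec _ _ fK.
have [s [us KE sv]] := polytope_vertices _ d0 pK.
exists b; split => // x; rewrite /facet_height dotC dotBr; congr (_ - _).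
have /(xgetPex 0)[_] : facet_vertices K f !=set0.
  by move: fK sv; rewrite KE => fK sv; exact: facet_vertices_neq0.
by rewrite [X in X _ -> _]fE => -[].
Qed.

(** The separating functional is made extreme, so that the points of [s] on its hyperplane determine
    that hyperplane; this will make the face it cuts out a facet. *)
Lemma extreme_separation s z : (0 < d)%N -> uniq s -> solid (seq_hull s) ->
  ~ seq_hull s z ->
  exists n b, [/\ forall p, p \in s -> dot n p <= b, b < dot n z &
    forall n' b', (forall p, p \in s -> dot n p = b -> dot n' p = b') ->
      exists c, n' = c *: n /\ b' = c * b].
Proof.
move=> d0 us sK zs; have [n0 [b0 [nb0 bz0]]] := separation _ _ us zs.
have [||| l [lneg zl lext]] := extreme_functional (seq_sub s)
    (fun i => lift1 (val i)) (lift1 z) (functional n0 b0).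
(* Solidity says that the lifted points span: an affine function vanishing on [s] is zero. *)
- move=> l; rewrite (functionalE l); set n := lsubmx _; set b := - _ => h.
  have nb x : seq_hull s x -> dot n x = b.
    apply: dot_seq_hull_eq => p ps; have := h (SeqSub ps).
    by rewrite dot_lift1 /= => /eqP; rewrite subr_eq0 => /eqP.
  rewrite (sK _ _ nb) (solid_neq _ _ _ d0 sK nb).
  by apply/rowP => i; rewrite /functional; case: (split_ordP i) => j ->;
    rewrite ?row_mxEl ?row_mxEr !mxE ?oppr0.
- by move=> i; rewrite dot_lift1 subr_le0; apply: nb0; exact: ssvalP.
- by rewrite dot_lift1 subr_gt0.
move: lneg zl lext; rewrite (functionalE l); set n := lsubmx _; set b := - _.
move=> lneg zl lext; exists n, b; split.
- by move=> p ps; have := lneg (SeqSub ps); rewrite dot_lift1 subr_le0.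
- by move: zl; rewrite dot_lift1 subr_gt0.
move=> n' b' h; have [|c] := lext (functional n' b').
  move=> i; rewrite !dot_lift1 => /eqP; rewrite subr_eq0 => /eqP /h ->.
    by rewrite subrr.
  exact: ssvalP.
by rewrite functionalZ => /functional_inj[-> ->]; exists c.
Qed.

(** By duality: if only multiples of one affine function vanish on [T], then the lifts of [T] span
    the lift of every point of the hyperplane, which is therefore the affine hull of [f]. *)
Lemma affine_dim_hyperplane f n b (T : seq 'rV[R]_d) p0 : n != 0 ->
  (f `<=` hyperplane n b) -> (forall p, p \in T -> f p) -> p0 \in T ->
  (forall n' b', (forall p, p \in T -> dot n' p = b') ->
      exists c, n' = c *: n /\ b' = c * b) ->
  has_affine_dim f d.-1.
Proof.
move=> n0 fn Tf p0T ext.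
have Tn p : p \in T -> dot n p = b by move=> /Tf/fn.
exists p0, (kermx n^T); split.
  by rewrite mxrank_ker mxrank_tr rank_rV n0 subn1.
have kerE x : ((x - p0 <= kermx n^T)%MS : Prop) = (dot n x = b).
  apply/propext; rewrite -(Tn _ p0T); split => [/sub_kermxP|h].
    move=> /matrixP/(_ 0 0); rewrite !mxE => h.
    apply/eqP; rewrite -subr_eq0 -dotBr dotC; apply/eqP; rewrite -h.
    by apply: eq_bigr => i _; rewrite !mxE.
  apply/sub_kermxP/matrixP => i j; rewrite !ord1 !mxE.
  rewrite -[RHS](subrr (dot n p0)) -[X in _ = X - _]h -dotBr dotC.
  by apply: eq_bigr => k _; rewrite !mxE.
apply/seteqP; split => y /=; rewrite kerE.
  move=> [N [p [c [pf c1 ->]]]]; rewrite dot_sumr -[RHS]mul1r -c1 mulr_suml.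
  by apply: eq_bigr => i _; rewrite dotZr (fn _ (pf i)).
move=> ny.
pose A := \matrix_(i < size T) lift1 (tnth (in_tuple T) i).
(* Each column of the cokernel is an affine function vanishing on [T], hence a multiple of the given
   one, which vanishes at [y]. *)
have /submxP[D DE] : (lift1 y <= A)%MS.
  rewrite submxE; apply/eqP/matrixP => i j; rewrite ord1 [RHS]mxE.
  pose l := (col j (cokermx A))^T.
  have lE (u : 'rV[R]_(d + 1)) : (u *m cokermx A) 0 j = dot u l.
    by rewrite mxE; apply: eq_bigr => k _; rewrite !mxE.
  rewrite lE; have := functionalE l; set n' := lsubmx _; set b' := - _ => lnE.
  have [|c [n'E b'E]] := ext n' b'.
    move=> p pT; apply/eqP; rewrite -subr_eq0 -dot_lift1 -lnE -lE.
    have /tnthP[k ->] : p \in in_tuple T by [].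
    have := mulmx_coker A => /matrixP/(_ k j); rewrite !mxE => Akj.
    by rewrite -[X in _ == X]Akj; apply/eqP; apply: eq_bigr => q _; rewrite [A k q]mxE.
  by rewrite lnE dot_lift1 n'E b'E dotZl ny subrr.
rewrite mulmx_sum_row in DE.
exists (size T), (tnth (in_tuple T)), (fun i => D 0 i); split.
- by move=> i; apply: Tf; exact: mem_tnth.
- move/(congr1 (fun u : 'rV[R]_(d + 1) => u 0 (rshift d 0))): DE.
  rewrite row_mxEr mxE => ->; rewrite summxE.
  by apply: eq_bigr => p _; rewrite rowK mxE row_mxEr mxE mulr1.
- move/(congr1 lsubmx): DE; rewrite row_mxKl => ->; rewrite linear_sum.
  by apply: eq_bigr => p _; rewrite linearZ /= rowK row_mxKl.
Qed.

(** An extreme separating hyperplane cuts out a facet, and its functional is a positive multiple of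
    the height's. *)
Lemma facet_separation K z : (0 < d)%N -> polytope K -> ~ K z ->
  exists2 f, facets K f & facet_height K f z < 0.
Proof.
move=> d0 pK Kz; have sK := polytope_solid _ pK.
have [s [us KE sv]] := polytope_vertices _ d0 pK.
have [||n [b [nb bz ext]]] := extreme_separation s z d0 us; rewrite -?KE//.
have Ks p : p \in s -> K p by rewrite KE; exact: mem_seq_hull.
(* If no point were on the hyperplane, extremality would hold vacuously: the pair [(0, 1)] would
   give [n = 0], and then no coordinate functional could be a multiple of [n]. *)
have [p0 p0s p0n] : exists2 p, p \in s & dot n p = b.
  apply: contrapT => h; have [|c [n'E b'E]] := ext 0 1.
    by move=> p ps np; case: h; exists p.
  have c0 : c != 0 by apply: contra_eq_neq b'E => ->; rewrite mul0r oner_neq0.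
  have nE : n = 0 by apply: (scalerI c0); rewrite -n'E scaler0.
  have [|c' [/rowP/(_ (Ordinal d0))]] := ext (delta_mx 0 (Ordinal d0)) 0.
    by move=> p ps np; case: h; exists p.
  by rewrite nE scaler0 !mxE !eqxx => /eqP; rewrite oner_eq0.
have n0 : n != 0.
  apply/eqP => nE; move: bz (p0n); rewrite nE !dot0l => bz b0.
  by rewrite -b0 ltxx in bz.
pose f := K `&` hyperplane n b.
have fK : facets K f.
  split.
    exists n, b; split => //; split => //; last by exists p0; split; first exact: Ks.
    by move=> y; rewrite KE; apply: dot_seq_hull_le.
  apply: (affine_dim_hyperplane f n b [seq p <- s | dot n p == b] p0) => //.
  - by move=> y [].
  - by move=> p; rewrite mem_filter => /andP[/eqP np ps]; split => //; exact: Ks.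
  - by rewrite mem_filter p0n eqxx.
  - move=> n' b' h; apply: ext => p ps np; apply: h.
    by rewrite mem_filter np eqxx.
exists f => //.
have [b' [en nb' fE hE]] := facet_dataP _ _ d0 pK fK.
rewrite hE; move: en nb' fE; set n' := facet_normal K f => en nb' fE.
have [|c [n'E b'E]] := ext n' b'.
  move=> p ps np; have : f p by split => //; exact: Ks.
  by rewrite fE => -[].
(* The unit length of [n'] excludes [c = 0]; for negative [c] both inequalities would make [n]
   constant on [K], against solidity. *)
have c_gt0 : 0 < c.
  rewrite lt_neqAle; apply/andP; split.
    apply/eqP => c0; move: en; rewrite n'E -c0 scale0r /enorm dot0l sqrtr0.
    by move=> /eqP; rewrite eq_sym oner_eq0.
  rewrite leNgt; apply/negP => c0; case/eqP: n0; apply: (sK _ b) => x.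
  rewrite KE; apply: dot_seq_hull_eq => p ps; apply/eqP.
  rewrite eq_le nb//= -(ler_nM2l c0) -dotZl -n'E -b'E nb'//; exact: Ks.
by rewrite n'E b'E dotZl -mulrBr pmulr_rlt0// subr_lt0.
Qed.

End Facets.

(** * Calculus of bounds on iterated partial derivatives *)

Section DerivativeBounds.
Context {R : realType} {d : nat}.
Context (U K : set 'rV[R]_d) (oU : open U) (KU : K `<=` U).
Implicit Types (rho B C : R) (f g : 'rV[R]_d -> R) (j : nat).

(* The partial derivatives of order l <= j are at most B * rho ^+ l on K. *)
Fixpoint deriv_bound rho j B g : Prop :=
  (forall x, K x -> `|g x| <= B) /\
  if j is j'.+1 then
    (forall i y, U y -> derivable g y (delta_mx 0 i)) /\
    forall i, deriv_bound rho j' (B * rho) (partial i g)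
  else True.

Lemma deriv_bound0 rho j B g : deriv_bound rho j B g ->
  forall x, K x -> `|g x| <= B.
Proof. by case: j => [[]|j []]. Qed.

(** Equality is asked on the open set [U] because derivatives see a neighbourhood of each point;
    differentiation rules valid only on [U] can thus be substituted. *)
Lemma eq_deriv_bound rho j B f g : (forall x, U x -> f x = g x) ->
  deriv_bound rho j B f -> deriv_bound rho j B g.
Proof.
elim: j B f g => [|j IH] B f g fg /= [fB] => [_|[df dfB]].
  by split => // x Kx; rewrite -fg ?fB//; exact: KU.
have nfg x : U x -> \forall y \near x, f y = g y.
  by move=> Ux; apply: filterS (fg) _; exact: open_nbhs_nbhs.
split; first by move=> x Kx; rewrite -fg ?fB//; exact: KU.
split => i; first by move=> y Uy; apply: near_eq_derivable (df i y Uy); exact: nfg.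
by apply: IH (dfB i) => x Ux; apply: near_eq_derive; exact: nfg.
Qed.

Lemma deriv_boundS rho j B g : deriv_bound rho j.+1 B g -> deriv_bound rho j B g.
Proof.
elim: j B g => [|j IH] B g /= [gB [dg dgB]]; first by split.
by split => //; split => // i; apply: IH; apply: dgB.
Qed.

Lemma le_deriv_bound rho rho' j B B' g : 0 <= B -> B <= B' -> 0 <= rho -> rho <= rho' ->
  deriv_bound rho j B g -> deriv_bound rho' j B' g.
Proof.
move=> + + r0 rr; elim: j B B' g => [|j IH] B B' g B0 BB' /= [gB].
  by move=> _; split => // x /gB /le_trans; apply.
move=> [dg dgB]; split; first by move=> x /gB /le_trans; apply.
by split => // i; apply: IH (dgB i); [exact: mulr_ge0|exact: ler_pM].
Qed.

Lemma deriv_bound_cst rho j B c : `|c| <= B -> 0 <= rho ->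
  deriv_bound rho j B (fun=> c).
Proof.
move=> cB r0; elim: j B c cB => [|j IH] B c cB /=; first by split.
split => //; split => [i y _|i]; first exact: derivable_cst.
have -> : partial i (fun=> c) = (fun=> 0 : R).
  by apply/funext => x; rewrite /partial derive_cst.
by apply: IH; rewrite normr0 mulr_ge0// (le_trans _ cB).
Qed.

Lemma deriv_boundD rho j B C f g :
  deriv_bound rho j B f -> deriv_bound rho j C g ->
  deriv_bound rho j (B + C) (fun x => f x + g x).
Proof.
have base (B' C' : R) f' g' : (forall x, K x -> `|f' x| <= B') ->
    (forall x, K x -> `|g' x| <= C') -> forall x, K x -> `|f' x + g' x| <= B' + C'.
  by move=> fB gC x Kx; rewrite (le_trans (ler_normD _ _))// lerD ?fB ?gC.
elim: j B C f g => [|j IH] B C f g /= [fB].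
  by move=> _ [gC _]; split => //; exact: base.
move=> [df dfB] [gC [dg dgC]]; split; first exact: base.
split => [i y Uy|i]; first by apply: derivableD; [exact: df|exact: dg].
apply: (eq_deriv_bound _ _ _ (fun x => partial i f x + partial i g x)).
  by move=> x Ux; rewrite /partial deriveD//; [exact: df|exact: dg].
by rewrite mulrDl; apply: IH.
Qed.

Lemma deriv_boundN rho j B f :
  deriv_bound rho j B f -> deriv_bound rho j B (fun x => - f x).
Proof.
elim: j B f => [|j IH] B f /= [fB].
  by split => // x Kx; rewrite normrN fB.
move=> [df dfB]; split; first by move=> x Kx; rewrite normrN fB.
split => [i y Uy|i]; first by apply: derivableN; exact: df.
apply: (eq_deriv_bound _ _ _ (fun x => - partial i f x)); last exact: IH.
by move=> x Ux; rewrite /partial deriveN//; exact: df.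
Qed.

(** By the product rule each order replaces one product by two, whence a factor 2 per order. *)
Lemma deriv_boundM rho j B C f g :
  deriv_bound rho j B f -> deriv_bound rho j C g ->
  deriv_bound rho j (2 ^+ j * (B * C)) (fun x => f x * g x).
Proof.
have base (B' C' : R) f' g' : (forall x, K x -> `|f' x| <= B') ->
    (forall x, K x -> `|g' x| <= C') -> forall x, K x -> `|f' x * g' x| <= B' * C'.
  by move=> fB gC x Kx; rewrite normrM ler_pM ?fB ?gC.
elim: j B C f g => [|j IH] B C f g.
  by move=> /= [fB _] [gC _]; split => //; rewrite mul1r; exact: base.
move=> fj gj; have := fj; have := gj => /= -[gC [dg dgC]] [fB [df dfB]]; split.
  move=> x Kx; rewrite (le_trans (base _ _ _ _ fB gC x Kx))//.
  rewrite ler_peMl ?exprn_ege1 ?ler1n// mulr_ge0//.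
    exact: le_trans (fB x Kx).
  exact: le_trans (gC x Kx).
split => [i y Uy|i]; first by apply: derivableM; [exact: df|exact: dg].
apply: (eq_deriv_bound _ _ _ (fun x => f x * partial i g x + g x * partial i f x)).
  by move=> x Ux; rewrite /partial deriveM//; [exact: df|exact: dg].
have -> : 2 ^+ j.+1 * (B * C) * rho =
    2 ^+ j * (B * (C * rho)) + 2 ^+ j * (C * (B * rho)) by rewrite exprS; ring.
by apply: deriv_boundD; apply: IH; rewrite //; exact: deriv_boundS.
Qed.

Lemma deriv_bound_sum rho j B (I : eqType) (s : seq I) (F : I -> 'rV[R]_d -> R) :
  0 <= rho -> (forall i, i \in s -> deriv_bound rho j B (F i)) ->
  deriv_bound rho j ((size s)%:R * B) (fun x => \sum_(i <- s) F i x).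
Proof.
move=> r0; elim: s => [_|i s IH FB].
  under eq_fun do rewrite big_nil.
  by apply: deriv_bound_cst => //; rewrite normr0 mul0r.
under eq_fun do rewrite big_cons.
have Bi := FB i (mem_head _ _).
rewrite /= -natr1 mulrDl mul1r addrC; apply: deriv_boundD Bi (IH _) => k ks.
by apply: FB; rewrite inE ks orbT.
Qed.

Lemma deriv_bound_prod rho j B (I : eqType) (s : seq I) (F : I -> 'rV[R]_d -> R) :
  0 <= rho -> (forall i, i \in s -> deriv_bound rho j B (F i)) ->
  deriv_bound rho j ((2 ^+ j * B) ^+ size s) (fun x => \prod_(i <- s) F i x).
Proof.
move=> r0; elim: s => [_|i s IH FB].
  under eq_fun do rewrite big_nil.
  by apply: deriv_bound_cst => //; rewrite normr1.
under eq_fun do rewrite big_cons.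
have Bi := FB i (mem_head _ _).
rewrite /= exprS -mulrA; apply: deriv_boundM Bi (IH _) => k ks.
by apply: FB; rewrite inE ks orbT.
Qed.

Lemma is_derive_affine b (n x v : 'rV[R]_d) :
  is_derive x v (fun y => b - dot n y) (- dot n v).
Proof.
have cv : (fun h : R => h^-1 *: (b - dot n (h *: v + x) - (b - dot n x)))
    @ 0^' --> (- dot n v).
  apply: cvg_near_cst; near=> h.
  have h0 : h != 0 by near: h; exact: nbhs_dnbhs_neq.
  rewrite dotDr dotZr /GRing.scale /=; field.
  exact: h0.
by apply: DeriveDef; [apply/cvg_ex; eexists; exact: cv|exact: cvg_lim cv].
Unshelve. all: by end_near. Qed.

Lemma deriv_bound_affine rho j B b n : 0 <= rho ->
  (forall x, K x -> `|b - dot n x| <= B) -> (forall i, `|n 0 i| <= B * rho) ->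
  deriv_bound rho j B (fun x => b - dot n x).
Proof.
move=> r0 nB ni; case: j => [|j] /=; first by split.
split => //; split => [i y _|i]; first by have [] := is_derive_affine b n y (delta_mx 0 i).
have -> : partial i (fun x => b - dot n x) = (fun=> - n 0 i).
  apply/funext => x; have [_] := is_derive_affine b n x (delta_mx 0 i).
  by rewrite /partial (dotC n) dot_deltal.
by apply: deriv_bound_cst => //; rewrite normrN.
Qed.

(** The recursion follows the derivative [- W' * (1/W) * (1/W)] of [1/W]: two products of functions
    bounded at the previous order. *)
Fixpoint inv_const j : R :=
  if j is j'.+1 then 2 ^+ j' * (2 ^+ j' * (inv_const j' * inv_const j')) else 1.

Lemma inv_const_ge1 j : 1 <= inv_const j.
Proof.
elim: j => //= j IH.
have h : 1 <= 2 ^+ j :> R by rewrite exprn_ege1// ler1n.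
by rewrite !mulr_ege1.
Qed.

(* Each derivative of 1/W costs a factor |W'|/W <= (A/w0) rho0, which is why
   the rate grows from rho0 to rho. *)
Lemma deriv_boundV rho0 A w0 j (W : 'rV[R]_d -> R) : 0 <= rho0 -> 0 < w0 -> w0 <= A ->
  (forall x, U x -> W x != 0) -> (forall x, K x -> w0 <= W x) ->
  deriv_bound rho0 j A W ->
  deriv_bound (A / w0 * rho0) j (inv_const j / w0) (fun x => (W x)^-1).
Proof.
move=> r0 w00 wA WU WK; set rho := A / w0 * rho0.
have A0 : 0 <= A by rewrite (le_trans (ltW w00)).
have Aw : 1 <= A / w0 by rewrite ler_pdivlMr// mul1r.
have rr : rho0 <= rho by rewrite ler_peMl.
have base x : K x -> `|(W x)^-1| <= w0^-1.
  move=> Kx; have Wx := WK x Kx; have W0 := lt_le_trans w00 Wx.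
  by rewrite gtr0_norm ?invr_gt0// lef_pV2 ?posrE.
elim: j => [|j IH] WA; first by split => // x Kx; rewrite mul1r base.
have Wj := IH (deriv_boundS _ _ _ _ WA).
have := WA => /= -[_ [dW dWA]]; split.
  move=> x Kx; apply: le_trans (base x Kx) _.
  by rewrite ler_peMl ?invr_ge0 ?(ltW w00)// (inv_const_ge1 j.+1).
split => [i y Uy|i]; first by apply: derivableV; [exact: WU|exact: dW].
apply: (eq_deriv_bound _ _ _
    (fun x => - partial i W x * ((W x)^-1 * (W x)^-1))).
  move=> x Ux; rewrite /partial deriveV//; [|exact: WU|exact: dW].
  by rewrite /GRing.scale /= expr2 invfM; ring.
have -> : 2 ^+ j * (2 ^+ j * (inv_const j * inv_const j)) / w0 * rho =
    2 ^+ j * (w0 * rho * (2 ^+ j * (inv_const j / w0 * (inv_const j / w0)))).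
  by field; rewrite gt_eqF.
apply: deriv_boundM; last exact: deriv_boundM.
have -> : w0 * rho = A * rho0 by rewrite /rho; field; rewrite gt_eqF.
apply/deriv_boundN/(le_deriv_bound rho0 _ _ (A * rho0)) => //.
exact: mulr_ge0.
Qed.

Lemma deriv_bound_iter rho j a B g i : deriv_bound rho (j + a) B g ->
  deriv_bound rho j (B * rho ^+ a) (iter a (partial i) g).
Proof.
elim: a j B g => [|a IH] j B g; first by rewrite addn0 mulr1.
rewrite addnS -addSn => /IH /= -[_ [_ /(_ i)]].
by rewrite -mulrA -exprSr.
Qed.

Lemma deriv_bound_mderive rho B g (alpha : {ffun 'I_d -> nat}) :
  deriv_bound rho (mi_size alpha) B g ->
  forall x, K x -> `|mderive alpha g x| <= B * rho ^+ mi_size alpha.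
Proof.
rewrite /mderive /mi_size -big_enum /= => gB.
(* Generalized to a list of coordinates with [j] orders left over for the partial derivatives still
   to be applied. *)
suff h s j : deriv_bound rho (j + \sum_(i <- s) alpha i) B g ->
    deriv_bound rho j (B * rho ^+ (\sum_(i <- s) alpha i))
      (foldr (fun i => iter (alpha i) (partial i)) g s).
  by apply: (deriv_bound0 _ 0); apply: h.
elim: s j => [|i s IH] j; first by rewrite big_nil addn0 mulr1.
rewrite big_cons addnA => /IH /= /deriv_bound_iter.
by rewrite -mulrA -exprD [(_ + alpha i)%N]addnC.
Qed.

End DerivativeBounds.

(** * Elementary estimates for norms, determinants and products *)

Section EuclideanBounds.
Context {R : realType} {d : nat}.
Implicit Types (x y n : 'rV[R]_d).

Lemma coord_le_enorm x i : `|x 0 i| <= enorm x.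
Proof.
rewrite /enorm -sqrtr_sqr ler_wsqrtr// /dot (bigD1 i)//= -expr2 lerDl.
by apply: sumr_ge0 => j _; rewrite -expr2 sqr_ge0.
Qed.

(** Cauchy-Schwarz, from the squared length of the component of [x] orthogonal to [n]. *)
Lemma dot_le_enorm n x : enorm n = 1 -> `|dot n x| <= enorm x.
Proof.
move=> n1; have nn : dot n n = 1.
  by rewrite -(sqr_sqrtr (dot_ge0 n)) -/(enorm n) n1 expr1n.
rewrite /enorm -sqrtr_sqr ler_wsqrtr//.
have := dot_ge0 (x - dot n x *: n).
rewrite dotBl !dotBr !dotZl !dotZr nn (dotC x n) => h.
rewrite expr2 -subr_ge0; move: h; congr (0 <= _); ring.
Qed.

Lemma enorm_le_coord x (M : R) : 0 <= M -> (forall i, `|x 0 i| <= M) ->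
  enorm x <= Num.sqrt (\sum_(i < d) M ^+ 2).
Proof.
move=> M0 xM; rewrite /enorm ler_wsqrtr//; apply: ler_sum => i _.
by rewrite -expr2 -real_normK ?num_real// lerXn2r ?nnegrE.
Qed.

Lemma det_le (A : 'M[R]_d) (c : R) :
  (forall i j, `|A i j| <= c) -> `|\det A| <= d`!%:R * c ^+ d.
Proof.
move=> Ac; apply: le_trans (ler_norm_sum _ _ _) _.
rewrite -card_Sn mulr_natl -sumr_const; apply: ler_sum => s _.
rewrite normrM normr_sign mul1r normr_prod.
have -> : c ^+ d = \prod_(i < d) c by rewrite prodr_const card_ord.
by apply: ler_prod => i _; rewrite normr_ge0 Ac.
Qed.

Lemma prod_seq_ge (I : eqType) (s : seq I) (F : I -> R) (c : R) : 0 <= c ->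
  (forall i, i \in s -> c <= F i) -> c ^+ size s <= \prod_(i <- s) F i.
Proof.
move=> c0; elim: s => [|i s IH] h; first by rewrite big_nil.
rewrite big_cons /= exprS ler_pM ?exprn_ge0// ?h ?mem_head//.
by apply: IH => j js; rewrite h// inE js orbT.
Qed.

(** Each property is assumed for all small [t], so the minimum of finitely many thresholds serves
    them all. *)
Lemma finite_common_pos (T : choiceType) (A : set T) (P : T -> R -> Prop) :
  finite_set A ->
  (forall a, A a -> exists2 e, 0 < e & forall t, 0 < t -> t <= e -> P a t) ->
  exists2 e, 0 < e & forall a, A a -> P a e.
Proof.
move=> /finite_seqP[s ->] h.
suff [e e0 eP] : exists2 e, 0 < e &
    forall a, a \in s -> forall t, 0 < t -> t <= e -> P a t.
  by exists e => // a /eP; apply.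
have {}h a : a \in s ->
    exists2 e, 0 < e & forall t, 0 < t -> t <= e -> P a t by exact: h.
elim: s h => [|a s IH] h; first by exists 1.
have [e e0 eP] := h a (mem_head _ _).
have [|e' e'0 e'P] := IH; first by move=> b bs; apply: h; rewrite inE bs orbT.
exists (Num.min e e'); first by rewrite lt_min e0.
move=> b; rewrite inE => /predU1P[->|bs] t t0; rewrite le_min => /andP[te te'].
  exact: eP.
exact: e'P.
Qed.

End EuclideanBounds.

(** * Heights, edges and sizes of a simple polytope *)

Section SimplePolytope.
Context {R : realType} {d : nat}.
Context {m n : nat} {K : set 'rV[R]_d}.
Context (d0 : (0 < d)%N) (n0 : (0 < n)%N).
Context (pK : polytope K) (simpleK : simple_polytope K).
Context (cardF : facets K #= `I_m) (cardV : vertices K #= `I_n).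
Implicit Types (x y z p v u : 'rV[R]_d) (f : set 'rV[R]_d).

Let finF : finite_set (facets K). Proof. by exists m. Qed.
Let finV : finite_set (vertices K). Proof. by exists n. Qed.

Lemma vertex_mem v : vertices K v -> K v.
Proof.
move=> [[e [b [_ vE]]] _].
by have : [set v] v by []; rewrite vE => -[].
Qed.

(** The point is that the supremum is over a bounded set: coordinates on [K] are bounded by the sum
    [M] of those of the vertices in absolute value. *)
Lemma diameter_ge x y : K x -> K y -> enorm (x - y) <= diameter K.
Proof.
move=> Kx Ky; have [s [us KE _]] := polytope_vertices _ d0 pK.
pose M := \sum_(p <- s) \sum_(i < d) `|p 0 i|.
have M0 : 0 <= M by apply: sumr_ge0 => p _; apply: sumr_ge0 => i _.
have sM p i : p \in s -> `|p 0 i| <= M.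
  move=> ps; rewrite /M (bigD1_seq p)//= (bigD1 i)//= -addrA lerDl addr_ge0//.
    by apply: sumr_ge0.
  by apply: sumr_ge0 => q _; apply: sumr_ge0.
have KM z i : K z -> `|z 0 i| <= M.
  rewrite KE => Kz; rewrite ler_norml -(dot_deltal i z); apply/andP; split.
    rewrite lerNl -dotNl; apply: dot_seq_hull_le Kz => p ps.
    by rewrite dotNl dot_deltal lerNl; have := sM p i ps; rewrite ler_norml => /andP[].
  apply: dot_seq_hull_le Kz => p ps.
  by rewrite dot_deltal; have := sM p i ps; rewrite ler_norml => /andP[].
apply: ub_le_sup; last by exists x, y.
exists (Num.sqrt (\sum_(i < d) (M + M) ^+ 2)) => r [x' [y' [Kx' Ky' ->]]].
apply: enorm_le_coord => [|i]; first exact: addr_ge0.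
by rewrite !mxE (le_trans (ler_normB _ _))// lerD ?KM.
Qed.

Lemma facet_height_ge0 f x : facets K f -> K x -> 0 <= facet_height K f x.
Proof.
move=> fK Kx; have [b [_ nb _ ->]] := facet_dataP _ _ d0 pK fK.
by rewrite subr_ge0 nb.
Qed.

Lemma facet_height_eq0 f x : facets K f -> K x -> f x <-> facet_height K f x = 0.
Proof.
move=> fK Kx; have [b [_ nb fE hE]] := facet_dataP _ _ d0 pK fK.
rewrite hE {1}fE; split => [[_ ->]|/eqP]; first by rewrite subrr.
by rewrite subr_eq0 eq_sym => /eqP.
Qed.

Lemma facet_height_gt0 f x : facets K f -> K x -> ~ f x -> 0 < facet_height K f x.
Proof.
move=> fK Kx fx; rewrite lt_neqAle facet_height_ge0// andbT.
by apply/eqP => /esym/(facet_height_eq0 f x fK Kx).2.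
Qed.

Lemma facet_height_le f x : facets K f -> K x -> facet_height K f x <= diameter K.
Proof.
move=> fK Kx; have [b [e1 nb fE ->]] := facet_dataP _ _ d0 pK fK.
have [p fp] : f !=set0 by case: fK => -[e [b' [[_ _ ne] ->]]] _.
have [Kp pb] : K p /\ dot (facet_normal K f) p = b by rewrite fE in fp; case: fp.
rewrite -pb -dotBr (le_trans (ler_norm _))//.
by rewrite (le_trans (dot_le_enorm _ _ e1))// diameter_ge.
Qed.

Lemma facet_heightD f x y : facets K f ->
  facet_height K f (x + y) = facet_height K f x - dot (facet_normal K f) y.
Proof.
move=> fK; have [b [_ _ _ hE]] := facet_dataP _ _ d0 pK fK.
by rewrite !hE dotDr opprD addrA.
Qed.

(* Only the facets through v constrain small displacements from v. *)
Lemma feasible_direction v y : K v ->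
  (forall f, facets K f -> f v -> dot (facet_normal K f) y <= 0) ->
  exists2 t, 0 < t & K (v + t *: y).
Proof.
move=> Kv yv.
have [|t t0 tP] := @finite_common_pos R _ (facets K)
    (fun f t => 0 <= facet_height K f (v + t *: y)) finF.
  move=> f fK; pose k := dot (facet_normal K f) y.
  have [fv|fv] := pselect (f v).
    exists 1 => // t t0 _; rewrite facet_heightD// dotZr.
    by rewrite addr_ge0 ?facet_height_ge0// oppr_ge0 mulr_ge0_le0 ?yv// ltW.
  have h0 := facet_height_gt0 _ _ fK Kv fv.
  have k0 : 0 < `|k| + 1 by rewrite ltr_wpDl.
  exists (facet_height K f v / (`|k| + 1)); first exact: divr_gt0.
  move=> t t0; rewrite ler_pdivlMr// facet_heightD// dotZr subr_ge0.
  apply: le_trans; rewrite ler_pM2l// -/k.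
  by rewrite (le_trans (ler_norm _))// lerDl.
exists t => //; apply: contrapT => /(facet_separation _ _ d0 pK)[f fK].
by rewrite ltNge tP.
Qed.

Lemma vertex_facets_enum v : vertices K v ->
  let nu := fun j : 'I_d => nth set0 (fset_set (vertex_facets K v)) j in
  [/\ forall j, facets K (nu j) /\ nu j v &
      forall f, facets K f -> f v -> exists j, f = nu j].
Proof.
move=> vK nu; have cv := simpleK v vK.
have finv : finite_set (vertex_facets K v) by exists d.
have sz : size (fset_set (vertex_facets K v)) = d by exact: card_fset_set.
split => [j|f fK fv].
  have : nu j \in fset_set (vertex_facets K v) by rewrite mem_nth// sz.
  by rewrite in_fset_set// => /set_mem.
have fin : f \in fset_set (vertex_facets K v) by rewrite in_fset_set//; exact: mem_set.
have jd : (index f (fset_set (vertex_facets K v)) < d)%N.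
  by rewrite -[ltnRHS]sz index_mem.
by exists (Ordinal jd); rewrite /nu nth_index.
Qed.

Lemma dot_normal_mx (nu : 'I_d -> set 'rV[R]_d) y j :
  (y *m normal_mx K nu) 0 j = dot y (facet_normal K (nu j)).
Proof. by rewrite mxE; apply: eq_bigr => i _; rewrite mxE. Qed.

(** A vector [y] orthogonal to all normals at [v] is feasible in both directions, so the functional
    exposing [v] is constant along [y]; the face it cuts out is [v] alone, hence [y = 0]. *)
Lemma normal_mx_unit v (nu : 'I_d -> set 'rV[R]_d) : vertices K v ->
  (forall f, facets K f -> f v -> exists j, f = nu j) ->
  normal_mx K nu \in unitmx.
Proof.
move=> vK nuP; rewrite -row_free_unit -kermx_eq0; apply: contraT => /rowV0Pn[y].
move=> /sub_kermxP yN y0.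
have yf f : facets K f -> f v -> dot (facet_normal K f) y = 0.
  by move=> fK fv; have [j ->] := nuP f fK fv; rewrite dotC -dot_normal_mx yN mxE.
have Kv := vertex_mem v vK.
have [t t0 Kt] : exists2 t, 0 < t & K (v + t *: y).
  by apply: feasible_direction => // f fK fv; rewrite yf.
have [t' t'0 Kt'] : exists2 t, 0 < t & K (v + t *: (- y)).
  by apply: feasible_direction => // f fK fv; rewrite dotNr yf// oppr0.
case: vK => [[e [b [[_ eb _] vE]]] _].
have ev : dot e v = b by have : [set v] v by []; rewrite vE => -[].
have ey : dot e y = 0.
  apply/eqP; rewrite eq_le -(pmulr_rle0 _ t0) -dotZr -(lerD2l (dot e v)) -dotDr.
  rewrite addr0 ev eb//= -oppr_le0 -(pmulr_rle0 _ t'0) -dotNr -dotZr.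
  by rewrite -(lerD2l (dot e v)) -dotDr addr0 ev eb.
have : [set v] (v + t *: y).
  by rewrite vE; split => //; rewrite /hyperplane /= dotDr dotZr ey mulr0 addr0.
move=> /eqP; rewrite -subr_eq0 addrAC subrr add0r scaler_eq0 gt_eqF//=.
by rewrite (negbTE y0).
Qed.

(** A small move along the edge leaving [nu i] stays in [K] and on the other facets at [v]. Writing
    the new point as a combination of vertices, all those of nonzero weight lie on the other facets,
    and one of them is off [nu i]. *)
Lemma edge_vertex v (nu : 'I_d -> set 'rV[R]_d) i : vertices K v ->
  (forall j, facets K (nu j) /\ nu j v) ->
  (forall f, facets K f -> f v -> exists j, f = nu j) ->
  exists u, [/\ vertices K u, ~ nu i u & forall j, j != i -> nu j u].
Proof.
move=> vK nuF nuP; have Nu := normal_mx_unit v nu vK nuP.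
have Kv := vertex_mem v vK.
(* Minus the dual basis vector of the normal of [nu i]. *)
pose y := - (delta_mx 0 i *m invmx (normal_mx K nu)) : 'rV[R]_d.
have yE j : dot (facet_normal K (nu j)) y = - (j == i)%:R.
  by rewrite dotC -dot_normal_mx mulNmx mulmxKV// !mxE eqxx.
have [t t0 Kt] : exists2 t, 0 < t & K (v + t *: y).
  apply: feasible_direction => // f fK fv; have [j ->] := nuP f fK fv.
  by rewrite yE oppr_le0 ler0n.
have hE j : facet_height K (nu j) (v + t *: y) = t * (j == i)%:R.
  have [fK fv] := nuF j; rewrite facet_heightD// dotZr yE mulrN opprK.
  by rewrite (facet_height_eq0 _ _ fK Kv).1// add0r.
have [s [us KE sv]] := polytope_vertices _ d0 pK.
move: (Kt); rewrite {1}KE => -[c [c0 c1 xE]].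
have supp j p : j != i -> p \in s -> c p != 0 -> nu j p.
  move=> ji ps cp; have [fK fv] := nuF j.
  have := hE j; rewrite (negbTE ji) mulr0.
  have [b [_ nb fE ->]] := facet_dataP _ _ d0 pK fK.
  move=> /eqP; rewrite subr_eq0 eq_sym => /eqP.
  have Ks q : q \in s -> K q by move=> /sv /vertex_mem.
  rewrite xE => /(hull_tight s _ _ _ (fun p ps => nb p (Ks p ps)) c0 c1) np.
  by rewrite fE; split; [exact: Ks|exact: np].
have [p [ps cp np]] : exists p, [/\ p \in s, c p != 0 & ~ nu i p].
  apply: contrapT => h; have [fK fv] := nuF i.
  have := hE i; rewrite eqxx mulr1.
  have [b [_ _ fE ->]] := facet_dataP _ _ d0 pK fK.
  rewrite xE dot_comb// big_seq big1 => [t0'|p ps]; first by rewrite -t0' ltxx in t0.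
  have [->|cp] := eqVneq (c p) 0; first by rewrite mul0r.
  have np : nu i p by apply: contrapT => np; apply: h; exists p.
  by rewrite fE in np; case: np => _ ->; rewrite subrr mulr0.
exists p; split => //; first exact: sv.
by move=> j ji; apply: supp.
Qed.


Lemma vertex_exists : exists v, vertices K v.
Proof.
apply: contrapT => /forallNP h; move: cardV.
have -> : vertices K = set0 by apply/seteqP; split => x // /h.
by rewrite card_eq_sym card_eq0 => /eqP II0; move: n0; have := II0;
  rewrite predeqE => /(_ 0%N)[+ _]; case: (n) => // k /(_ isT).
Qed.

Lemma hstar_le f v : facets K f -> vertices K v -> ~ f v ->
  hstar K <= facet_height K f v.
Proof.
move=> fK vK fv; apply: ge_inf; last by exists f, v.
exists 0 => r [g [u [gK uK _ ->]]]; apply: facet_height_ge0 => //.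
exact: vertex_mem.
Qed.

(** The infimum is over finitely many positive heights, and [edge_vertex] provides at least one. *)
Lemma hstar_gt0 : 0 < hstar K.
Proof.
have [v vK] := vertex_exists; have [nuF nuP] := vertex_facets_enum v vK.
have [u [uK nu0 _]] := edge_vertex _ _ (Ordinal d0) vK nuF nuP.
have [||e e0 eP] := @finite_common_pos R _ (facets K `*` vertices K)
  (fun fv t => ~ fv.1 fv.2 -> t <= facet_height K fv.1 fv.2).
- exact: finite_setX.
- move=> [f w] /= [fK wK]; have [fw|fw] := pselect (f w); first by exists 1.
  by exists (facet_height K f w) => //; apply: facet_height_gt0 => //; exact: vertex_mem.
apply: lt_le_trans e0 _; apply: lb_le_inf.
  by eexists; exists (nth set0 (fset_set (vertex_facets K v)) (Ordinal d0)), u;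
    split => //; exact: (nuF _).1.
by move=> r [f [w [fK wK fw ->]]]; exact: (eP (f, w)).
Qed.

Lemma hstar_le_diameter : hstar K <= diameter K.
Proof.
have [v vK] := vertex_exists; have [nuF nuP] := vertex_facets_enum v vK.
have [u [uK nu0 _]] := edge_vertex _ _ (Ordinal d0) vK nuF nuP.
apply: le_trans (hstar_le _ _ (nuF (Ordinal d0)).1 uK nu0) _.
apply: facet_height_le; first exact: (nuF _).1.
exact: vertex_mem.
Qed.

Lemma diameter_gt0 : 0 < diameter K.
Proof. exact: lt_le_trans hstar_gt0 hstar_le_diameter. Qed.

(** * Two-sided control of determinants, weights and their sum *)

Lemma vertex_det_le v : vertices K v -> vertex_det K v <= d`!%:R.
Proof.
move=> vK; have [nuF nuP] := vertex_facets_enum v vK.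
rewrite -[leRHS]mulr1 -[X in _ * X](expr1n R d); apply: det_le => i j; rewrite mxE.
have [b [<- _ _ _]] := facet_dataP _ _ d0 pK (nuF j).1.
exact: coord_le_enorm.
Qed.

(* The edge vectors at v are dual to the normals of the facets through v, up to
   the heights of the opposite vertices. *)
Lemma vertex_det_ge v : vertices K v ->
  hstar K ^+ d <= vertex_det K v * (d`!%:R * diameter K ^+ d).
Proof.
move=> vK; have [nuF nuP] := vertex_facets_enum v vK.
move: nuF nuP; rewrite /vertex_det; set nu := (fun j : 'I_d => _) => nuF nuP.
have /choice[u uP] i := edge_vertex v nu i vK nuF nuP.
have Kv := vertex_mem v vK.
pose E := \matrix_(i < d, j < d) (v - u i) 0 j.
have EN : E *m normal_mx K nu =
    diag_mx (\row_i facet_height K (nu i) (u i)).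
  apply/matrixP => i j; have [uK ui uj] := uP i.
  have Ku := vertex_mem _ uK.
  have -> : (E *m normal_mx K nu) i j = dot (v - u i) (facet_normal K (nu j)).
    by rewrite mxE; apply: eq_bigr => k _; rewrite !mxE.
  have [fK fv] := nuF j.
  have -> : dot (v - u i) (facet_normal K (nu j)) = facet_height K (nu j) (u i).
    rewrite -[in RHS](subrKC v (u i)) facet_heightD//.
    by rewrite (facet_height_eq0 _ _ fK Kv).1// sub0r -dotNr opprB dotC.
  rewrite !mxE; case: eqVneq => [->//|ij]; rewrite mulr0n.
  by apply/(facet_height_eq0 _ _ fK Ku)/uj; rewrite eq_sym.
have detE : \det E * \det (normal_mx K nu) =
    \prod_i facet_height K (nu i) (u i).
  by rewrite -det_mulmx EN det_diag; apply: eq_bigr => i _; rewrite mxE.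
have hd : hstar K ^+ d <= \prod_i facet_height K (nu i) (u i).
  have -> : hstar K ^+ d = \prod_(i < d) hstar K by rewrite prodr_const card_ord.
  apply: ler_prod => i _; rewrite (ltW hstar_gt0) /=.
  by have [uK ui _] := uP i; exact: hstar_le (nuF i).1 uK ui.
apply: le_trans hd _; rewrite -detE mulrC (le_trans (ler_norm _))//.
rewrite normrM ler_wpM2l//; apply: det_le => i j; rewrite mxE.
apply: le_trans (coord_le_enorm _ _) _; apply: diameter_ge => //.
by have [uK _ _] := uP i; exact: vertex_mem.
Qed.

(** Heights are affine and nonnegative on the vertices, so the one at [x] is at least the
    contribution of a single vertex of weight at least [1/n]. *)
Lemma dominant_vertex x : K x -> exists2 v, vertices K v &
  forall f, facets K f -> ~ f v -> hstar K / n%:R <= facet_height K f x.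
Proof.
have [s [us KE sv]] := polytope_vertices _ d0 pK.
move=> Kx; move: (Kx); rewrite {1}KE => -[c [c0 c1 xE]].
have szn : (size s <= n)%N.
  rewrite -(card_fset_set cardV); apply: uniq_leq_size => // p /sv pV.
  by rewrite in_fset_set//; exact: mem_set.
have nR : 0 < n%:R :> R by rewrite ltr0n.
have [p ps cp] : exists2 p, p \in s & n%:R^-1 <= c p.
  apply: contrapT => h; have : \sum_(p <- s) c p < 1; last by rewrite c1 ltxx.
  have sp p : p \in s -> c p < n%:R^-1.
    by move=> ps; rewrite ltNge; apply/negP => cp; apply: h; exists p.
  have [s0|s0] := leqP (size s) 0.
    by move: s0; rewrite leqn0 => /nilP ->; rewrite big_nil.
  apply: (@lt_le_trans _ _ (\sum_(p <- s) n%:R^-1)).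
    case: s s0 sp {KE sv us c1 xE szn h} => // q s _ sp.
    rewrite !big_cons ltr_leD ?sp ?mem_head// big_seq [leRHS]big_seq.
    by apply: ler_sum => p ps; rewrite ltW// sp// inE ps orbT.
  rewrite big_const_seq count_predT iter_addr addr0.
  by rewrite -[leLHS]mulr_natl ler_pdivrMr// mul1r ler_nat.
exists p; first exact: sv.
move=> f fK fp; have [b [_ nb fE hE]] := facet_dataP _ _ d0 pK fK.
have Ks q : q \in s -> K q by move=> /sv /vertex_mem.
rewrite hE xE dot_comb// (bigD1_seq p)//= -[leLHS]addr0 lerD//.
  by rewrite mulrC ler_pM ?invr_ge0 ?(ltW hstar_gt0)// -hE; apply: hstar_le => //; exact: sv.
rewrite big_seq_cond; apply: sumr_ge0 => q /andP[qs _].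
by rewrite mulr_ge0// subr_ge0 nb//; exact: Ks.
Qed.


Lemma card_facets_ge : (d <= m)%N.
Proof.
have [v vK] := vertex_exists.
have cv := card_fset_set (simpleK v vK).
rewrite -[leqRHS](card_fset_set cardF) -[leqLHS]cv.
apply: fsubset_leq_card; apply/fsubsetP => f.
have finv : finite_set (vertex_facets K v) by exists d; exact: simpleK.
by rewrite !in_fset_set// => /set_mem[fK _]; exact: mem_set.
Qed.

Definition far_facets v : seq (set 'rV[R]_d) :=
  fset_set (facets K `\` vertex_facets K v).

Lemma mem_far_facets v f : f \in far_facets v -> facets K f /\ ~ f v.
Proof.
rewrite /far_facets in_fset_set; last exact: finite_setD.
by move=> /set_mem[fK fv]; split => // ?; apply: fv.
Qed.

Lemma size_far_facets v : vertices K v -> size (far_facets v) = (m - d)%N.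
Proof.
move=> vK; have finv : finite_set (vertex_facets K v) by exists d; exact: simpleK.
rewrite /far_facets fset_setD// cardfsDS; last first.
  apply/fsubsetP => f; rewrite !in_fset_set// => /set_mem[fK _]; exact: mem_set.
by rewrite (card_fset_set cardF) (card_fset_set (simpleK v vK)).
Qed.

Lemma wachspress_weightE v x : wachspress_weight K v x =
  vertex_det K v * \prod_(f <- far_facets v) facet_height K f x.
Proof. by rewrite /wachspress_weight fsbig_finite//; exact: finite_setD. Qed.

Definition weight_sum x : R :=
  \sum_(u <- fset_set (vertices K)) wachspress_weight K u x.

Lemma wachspressE v x : wachspress K v x = wachspress_weight K v x / weight_sum x.
Proof. by rewrite /wachspress fsbig_finite. Qed.

Lemma wachspress_weight_ge0 v x : K x -> 0 <= wachspress_weight K v x.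
Proof.
move=> Kx; rewrite wachspress_weightE mulr_ge0 ?normr_ge0// big_seq prodr_ge0//.
by move=> f /mem_far_facets[fK _]; exact: facet_height_ge0.
Qed.

(** Product of the bound on the determinant from [vertex_det_ge] and of [m - d] heights, each at
    least [hstar K / n] by [dominant_vertex]. *)
Definition weight_lb : R :=
  hstar K ^+ m / (d`!%:R * diameter K ^+ d * n%:R ^+ (m - d)).

Lemma weight_lb_den : 0 < d`!%:R * diameter K ^+ d * n%:R ^+ (m - d).
Proof. by rewrite !mulr_gt0 ?exprn_gt0 ?diameter_gt0 ?ltr0n ?fact_gt0. Qed.

Lemma weight_lb_gt0 : 0 < weight_lb.
Proof. by rewrite divr_gt0 ?weight_lb_den// exprn_gt0// hstar_gt0. Qed.

Lemma weight_sum_ge x : K x -> weight_lb <= weight_sum x.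
Proof.
move=> Kx; have [v vK vx] := dominant_vertex x Kx.
have vin : v \in enum_fset (fset_set (vertices K)).
  by rewrite in_fset_set//; exact: mem_set.
have hs0 := ltW hstar_gt0; have n0R : 0 < n%:R :> R by rewrite ltr0n.
apply: (@le_trans _ _ (wachspress_weight K v x)); last first.
  rewrite /weight_sum (bigD1_seq v vin (fset_uniq _)) /= lerDl sumr_ge0// => u _.
  exact: wachspress_weight_ge0.
rewrite wachspress_weightE /weight_lb ler_pdivrMr ?weight_lb_den//.
have prod_ge : (hstar K / n%:R) ^+ (m - d) <=
    \prod_(f <- far_facets v) facet_height K f x.
  rewrite -(size_far_facets v vK); apply: prod_seq_ge => [|f /mem_far_facets[]].
    by rewrite divr_ge0// ltW.
  exact: vx.
have -> : hstar K ^+ m = hstar K ^+ d * ((hstar K / n%:R) ^+ (m - d) * n%:R ^+ (m - d)).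
  rewrite expr_div_n divfK ?expf_neq0 ?gt_eqF// -exprD subnKC//.
  exact: card_facets_ge.
rewrite [leRHS](_ : _ = vertex_det K v * (d`!%:R * diameter K ^+ d) *
   (\prod_(f <- far_facets v) facet_height K f x * n%:R ^+ (m - d))); last by ring.
rewrite ler_pM ?vertex_det_ge ?ler_wpM2r ?exprn_ge0 ?(ltW n0R)//.
by rewrite mulr_ge0 ?exprn_ge0 ?divr_ge0 ?(ltW n0R).
Qed.

Lemma weight_sum_continuous : continuous weight_sum.
Proof.
have hc f : continuous (facet_height K f : 'rV[R]_d -> R).
  rewrite /facet_height /dot; apply: continuous_big => [|i _ x].
    exact: add_continuous.
  apply: (@continuousM R _ (fun y => (xget 0 (facet_vertices K f) - y) 0 i)
    (fun=> facet_normal K f 0 i)); last exact: cst_continuous.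
  have -> : (fun y => (xget 0 (facet_vertices K f) - y) 0 i) =
      (fun=> xget 0 (facet_vertices K f) 0 i) - (fun y : 'rV[R]_d => y 0 i).
    by apply/funext => y; rewrite !mxE.
  by apply: continuousB; [exact: cst_continuous|exact: coord_continuous].
rewrite /weight_sum; apply: continuous_big => [|u _ x]; first exact: add_continuous.
have -> : wachspress_weight K u = (fun=> vertex_det K u) \*
    (fun y => \prod_(f <- far_facets u) facet_height K f y).
  by apply/funext => y; rewrite wachspress_weightE.
apply: continuousM; first exact: cst_continuous.
by apply: continuous_big => [|f _]; [exact: mul_continuous|exact: hc].
Qed.

(** * Derivatives of the weights and of the coordinates *)

Definition weight_ub j : R :=
  n%:R * (2 ^+ j * (d`!%:R * (2 ^+ j * diameter K) ^+ (m - d))).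

(** At the rate [1 / diameter K] a height obeys the bound [diameter K] at every order, its gradient
    being a unit vector up to sign. *)
Lemma weight_deriv_bound (U : set 'rV[R]_d) j v : open U -> K `<=` U -> vertices K v ->
  deriv_bound U K (diameter K)^-1 j
    (2 ^+ j * (d`!%:R * (2 ^+ j * diameter K) ^+ (m - d))) (wachspress_weight K v).
Proof.
move=> oU KU vK; have h0 := diameter_gt0.
have r0 : 0 <= (diameter K)^-1 by rewrite invr_ge0 ltW.
rewrite (_ : wachspress_weight K v = fun x =>
  vertex_det K v * \prod_(f <- far_facets v) facet_height K f x); last first.
  by apply/funext => x; exact: wachspress_weightE.
apply: deriv_boundM => //.
  by apply: deriv_bound_cst => //; rewrite normr_id vertex_det_le.
rewrite -(size_far_facets v vK); apply: deriv_bound_prod => // f /mem_far_facets[fK _].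
have hle x : K x -> `|facet_height K f x| <= diameter K.
  by move=> Kx; rewrite ger0_norm ?facet_height_ge0 ?facet_height_le.
have [b [e1 _ _ hE]] := facet_dataP _ _ d0 pK fK.
rewrite (_ : facet_height K f = fun x => b - dot (facet_normal K f) x); last first.
  by apply/funext.
apply: deriv_bound_affine => // [x Kx|i]; first by rewrite -hE hle.
by rewrite divff ?gt_eqF// -e1 coord_le_enorm.
Qed.

Lemma weight_sum_deriv_bound (U : set 'rV[R]_d) j : open U -> K `<=` U ->
  deriv_bound U K (diameter K)^-1 j (weight_ub j) weight_sum.
Proof.
move=> oU KU; rewrite /weight_ub -{1}(card_fset_set cardV).
apply: deriv_bound_sum => //; first by rewrite invr_ge0 ltW// diameter_gt0.
move=> v; rewrite in_fset_set// => /set_mem; exact: weight_deriv_bound.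
Qed.

(** The part of [weight_ub j / weight_lb] that does not depend on [K]. *)
Definition ratio_const j : R :=
  n%:R * 2 ^+ j * (2 ^+ j) ^+ (m - d) * d`!%:R * d`!%:R * n%:R ^+ (m - d).

Lemma ratio_const_ge1 j : 1 <= ratio_const j.
Proof.
have h : 1 <= 2 ^+ j :> R by rewrite exprn_ege1// ler1n.
by rewrite !mulr_ege1// ?exprn_ege1// ler1n ?fact_gt0.
Qed.

Lemma weight_ratio j :
  weight_ub j / weight_lb = ratio_const j * (diameter K / hstar K) ^+ m.
Proof.
have hs0 := hstar_gt0; have h0 := diameter_gt0.
rewrite /weight_lb invf_div mulrA /weight_ub /ratio_const exprMn expr_div_n.
rewrite -[in RHS](subnK card_facets_ge) [in RHS]exprD.
by rewrite (subnK card_facets_ge); ring.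
Qed.

Lemma mderive_wachspress_le v x (alpha : {ffun 'I_d -> nat}) (j := mi_size alpha) :
  vertices K v -> K x ->
  `|mderive alpha (wachspress K v) x| <=
    2 ^+ j * inv_const j * ratio_const j ^+ j.+1 *
      (diameter K ^+ (m * (1 + j)) * (diameter K ^+ j)^-1 / hstar K ^+ (m * (1 + j))).
Proof.
move=> vK Kx; have hs0 := hstar_gt0; have h0 := diameter_gt0.
have w0 := weight_lb_gt0.
(* An open neighbourhood of [K] on which the quotient is differentiable, so boundary points of [K]
   need no separate treatment. *)
pose U : set 'rV[R]_d := weight_sum @^-1` [set y | 0 < y].
have oU : open U.
  apply: open_comp => [y _|]; first exact: weight_sum_continuous.
  exact: open_gt.
have KU : K `<=` U by move=> y Ky; apply: lt_le_trans w0 (weight_sum_ge y Ky).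
have ub1 : weight_lb <= weight_ub j.
  rewrite -[leLHS]mul1r -ler_pdivlMr// weight_ratio mulr_ege1 ?ratio_const_ge1//.
  by rewrite exprn_ege1// ler_pdivlMr// mul1r hstar_le_diameter.
have ub0 : 0 <= weight_ub j by rewrite (le_trans (ltW w0)).
set rho := weight_ub j / weight_lb * (diameter K)^-1.
have r0 : 0 <= (diameter K)^-1 by rewrite invr_ge0 ltW.
have rr : (diameter K)^-1 <= rho.
  by rewrite ler_peMl// ler_pdivlMr// mul1r.
have W1 : deriv_bound U K rho j (inv_const j / weight_lb) (fun x => (weight_sum x)^-1).
  apply: deriv_boundV => //; last exact: weight_sum_deriv_bound.
    by move=> y Uy; rewrite gt_eqF.
  exact: weight_sum_ge.
have Wv : deriv_bound U K rho j (weight_ub j) (wachspress_weight K v).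
  apply: le_deriv_bound (weight_deriv_bound _ _ _ oU KU vK) => //.
    by rewrite !mulr_ge0 ?exprn_ge0 ?mulr_ge0 ?exprn_ge0 ?(ltW h0).
  rewrite /weight_ub ler_peMl ?ler1n//.
  by rewrite !mulr_ge0 ?exprn_ge0 ?mulr_ge0 ?exprn_ge0 ?(ltW h0).
have := deriv_boundM _ _ oU KU _ _ _ _ _ _ Wv W1.
rewrite (_ : (fun x => _) = wachspress K v); last first.
  by apply/funext => y; rewrite wachspressE.
move=> /deriv_bound_mderive/(_ x Kx)/le_trans; apply.
(* One ratio [weight_ub j / weight_lb] comes from the product of the weight with [1/W], and [j] more
   from the rate [rho]. *)
rewrite -/j [leLHS](_ : _ = 2 ^+ j * inv_const j *
  (weight_ub j / weight_lb) ^+ j.+1 * (diameter K)^-1 ^+ j); last first.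
  by rewrite /rho exprMn exprS; ring.
rewrite weight_ratio exprMn -exprM add1n exprVn expr_div_n.
rewrite le_eqVlt; apply/orP; left; apply/eqP; ring.
Qed.

End SimplePolytope.

(** * Comparison with the double sum *)

Lemma mi_le_finite d (alpha : {ffun 'I_d -> nat}) :
  finite_set [set beta : {ffun 'I_d -> nat} | mi_le beta alpha].
Proof.
pose g (b : {ffun 'I_d -> 'I_(mi_size alpha).+1}) := [ffun i => b i : nat].
apply: (@sub_finite_set _ _ (range g)).
  move=> b ba; exists [ffun i => inord (b i)] => //.
  apply/ffunP => i; rewrite !ffunE inordK// ltnS (leq_trans (ba i))//.
  by rewrite /mi_size (bigD1 i)//= leq_addr.
apply: finite_image; exact: finite_finset.
Qed.

Theorem lemma3p6 (R : realType) (d : nat) (d_ge1 : (1 <= d)%N)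
    (alpha : {ffun 'I_d -> nat}) (m n : nat) (m_gt0 : (0 < m)%N)
    (n_gt0 : (0 < n)%N) :
  exists2 C : R, 0 < C &
    forall K : set 'rV[R]_d,
      polytope K -> simple_polytope K -> nondegenerate_polytope K ->
      facets K #= `I_m -> vertices K #= `I_n ->
      forall v x : 'rV[R]_d, vertices K v -> K x ->
        `|mderive alpha (wachspress K v) x| <=
        C * \sum_(beta \in [set beta : {ffun 'I_d -> nat} |
                     mi_le beta alpha /\
                     ((mi_size (mi_sub alpha beta))%:Z <= m%:Z - d%:Z)%R])
              \sum_(minn (mi_size beta) 1 <= lambda < (mi_size beta).+1)
                (diameter K ^ ((m * (1 + lambda))%:Z - (mi_size alpha)%:Z)
                 / hstar K ^+ (m * (1 + lambda))).
Proof.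
exists (2 ^+ mi_size alpha * inv_const (mi_size alpha) *
  @ratio_const R d m n (mi_size alpha) ^+ (mi_size alpha).+1).
  have rc := @ratio_const_ge1 R d m n n_gt0 (mi_size alpha).
  have ic := @inv_const_ge1 R (mi_size alpha).
  by rewrite !mulr_gt0 ?exprn_gt0 ?(lt_le_trans ltr01 rc) ?(lt_le_trans ltr01 ic).
move=> K pK sK _ cardF cardV v x vK Kx; set j := mi_size alpha.
have hs0 := hstar_gt0 d_ge1 n_gt0 pK sK cardF cardV.
have h0 := diameter_gt0 d_ge1 n_gt0 pK sK cardF cardV.
apply: le_trans (mderive_wachspress_le d_ge1 n_gt0 pK sK cardF cardV _ _ alpha vK Kx) _.
rewrite ler_wpM2l//.
  have rc := @ratio_const_ge1 R d m n n_gt0 j.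
  have ic := @inv_const_ge1 R j.
  by rewrite !mulr_ge0 ?exprn_ge0 ?(le_trans ler01 rc) ?(le_trans ler01 ic).
have term0 k l : 0 <= diameter K ^ k / hstar K ^+ l.
  by rewrite divr_ge0 ?exprz_ge0 ?exprn_ge0 ?ltW.
(* Only [beta = alpha] is kept; it is admissible since [alpha - alpha] has size 0 and [d <= m]. *)
rewrite (fsbigD1 alpha)/=; last 2 first.
- by apply: sub_finite_set (mi_le_finite _ alpha) => b [].
- split => [i//|]; rewrite /mi_size big1 => [|i _]; last by rewrite ffunE subnn.
  by rewrite subr_ge0 lez_nat (card_facets_ge n_gt0 sK cardF cardV).
rewrite -[leLHS]addr0 lerD//; last first.
  by apply: fsumr_ge0 => b _; apply: sumr_ge0 => l _.
(* Of the inner sum only the last index, [lambda = j], is kept. *)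
rewrite -/j big_nat_recr /=; last exact: geq_minl.
rewrite -[leLHS]add0r lerD//; first by apply: sumr_ge0 => l _.
by rewrite expfzDr ?gt_eqF// -exprnN.
Qed.
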